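(* The space $\mathcal{X}$ of mm-isomorphism classes of mm-spaces with the concentration topology is locally path connected, and the space $\Pi$ of pyramids with the weak topology is locally path connected.
   Context: An mm-space is a triple $(X,d_X,\mu_X)$ with $(X,d_X)$ complete separable metric and $\mu_X$ a Borel probability measure; mm-isomorphism means an isometry between supports pushing $\mu_X$ to $\mu_Y$; $\mathcal{X}$ is the set of mm-isomorphism classes. A parameter of $X$ is a Borel map $\varphi\colon I=[0,1)\to X$ with $\varphi_*\mathcal{L}^1=\mu_X$. Box distance: $\square(X,Y)$ is the infimum of $\varepsilon\ge0$ such that there are parameters $\varphi,\psi$ of $X,Y$ and Borel $I_0\subset I$ with $\mathcal{L}^1(I_0)\ge1-\varepsilon$ and $|d_X(\varphi(s),\varphi(t))-d_Y(\psi(s),\psi(t))|\le\varepsilon$ for $s,t\in I_0$. Observable distance: $d_{\mathrm{conc}}(X,Y)=\inf_{\varphi,\psi}d_{\mathrm{H}}(\{f\circ\varphi\},\{g\circ\psi\})$ where $f,g$ range over real 1-Lipschitz functions on $X$, $Y$, and $d_{\mathrm{H}}$ is the Hausdorff distance for the Ky Fan metric $d_{\mathrm{KF}}(u,v)=\inf\{\varepsilon\ge0:\mathcal{L}^1(|u-v|>\varepsilon)\le\varepsilon\}$; it induces the concentration topology. Lipschitz order: $Y\prec X$ if there is a 1-Lipschitz $f\colon X\to Y$ with $f_*\mu_X=\mu_Y$. A pyramid is a nonempty $\square$-closed set $\mathcal{P}\subset\mathcal{X}$ such that $X\in\mathcal{P}$, $Y\prec X$ imply $Y\in\mathcal{P}$,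 and any $Y,Y'\in\mathcal{P}$ have a common upper bound $X\in\mathcal{P}$ for $\prec$. $\Pi$ is the set of pyramids. Pyramids $\mathcal{P}_n$ converge weakly to $\mathcal{P}$ if $\square(X,\mathcal{P}_n)\to0$ for every $X\in\mathcal{P}$ and $\liminf_n\square(X,\mathcal{P}_n)>0$ for every $X\notin\mathcal{P}$. The weak topology on $\Pi$ is the topology of a metric $\rho$ on $\Pi$ compatible with weak convergence (e.g. $\rho(\mathcal{P},\mathcal{P}')=\sum_{k\ge1}2^{-k-2}k^{-1}d_{\mathrm{H}}(\mathcal{P}\cap\mathcal{X}(k,k),\mathcal{P}'\cap\mathcal{X}(k,k))$, with $d_{\mathrm{H}}$ the $\square$-Hausdorff distance and $\mathcal{X}(N,R)$ the set of spaces $(\mathbb{R}^N,\|\cdot\|_\infty,\mu)$ with $\operatorname{supp}\mu$ in the closed $R$-ball about $0$). *)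

(* Defs.v *)
From HB Require Import structures.
From mathcomp Require Import all_boot all_order all_algebra.
From mathcomp Require Import all_classical all_reals.
From mathcomp Require Import topology normedtype sequences measure lebesgue_measure probability.
Set Implicit Arguments.
Unset Strict Implicit.
Unset Printing Implicit Defensive.
Import Order.TTheory GRing.Theory Num.Theory.
Local Open Scope classical_set_scope.
Local Open Scope ring_scope.

Section Defs.
Variable R : realType.

Definition is_metric (T : Type) (d : T -> T -> R) : Prop :=
  [/\ forall x y, 0 <= d x y,
      forall x y, d x y = 0 <-> x = y,
      forall x y, d x y = d y x &
      forall x y z, d x z <= d x y + d y z].

Definition d_complete (T : Type) (d : T -> T -> R) : Prop :=
  forall u : nat -> T,
    (forall e : R, 0 < e -> exists N : nat, forall m n : nat,
        (N <= m)%N -> (N <= n)%N -> d (u m) (u n) < e) ->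
    exists x : T, forall e : R, 0 < e -> exists N : nat, forall n : nat,
        (N <= n)%N -> d (u n) x < e.

Definition d_separable (T : Type) (d : T -> T -> R) : Prop :=
  exists s : nat -> T, forall x : T, forall e : R, 0 < e ->
    exists n : nat, d x (s n) < e.

Definition d_open (T : Type) (d : T -> T -> R) (U : T -> Prop) : Prop :=
  forall x, U x -> exists2 e : R, 0 < e & forall y, d x y < e -> U y.

Record mmspace := MMSpace {
  mm_disp : measure_display;
  mm_carrier : measurableType mm_disp;
  mm_dist : mm_carrier -> mm_carrier -> R;
  mm_metric : is_metric mm_dist;
  mm_complete : d_complete mm_dist;
  mm_separable : d_separable mm_dist;
  mm_borel : @measurable _ mm_carrier = <<s d_open mm_dist >>;
  mm_measure : probability mm_carrier R
}.

Definition leb : set (measurableTypeR R) -> \bar R := @lebesgue_measure R.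
Definition I01 : set R := `[0, 1[%classic.

(** parameters: Borel maps phi : I -> X with phi_* L^1 = mu_X
   (phi is a total function R -> X; only its restriction to I matters) *)
Definition parameter (X : mmspace) (phi : R -> mm_carrier X) : Prop :=
  measurable_fun (I01 : set (measurableTypeR R)) phi /\
  forall B : set (mm_carrier X), measurable B ->
    leb (I01 `&` phi @^-1` B) = mm_measure X B.

Definition lip1 (X : mmspace) (f : mm_carrier X -> R) : Prop :=
  forall x y, `|f x - f y| <= mm_dist x y.

Definition dKF (u v : R -> R) : R :=
  inf [set e : R | 0 <= e /\
        (leb (I01 `&` [set t | (e < `|u t - v t|)%R]) <= e%:E)%E].

Definition hausdorff (T : Type) (dd : T -> T -> R) (A B : set T) : R :=
  Num.max (sup [set inf [set dd u v | v in B] | u in A])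
          (sup [set inf [set dd u v | u in A] | v in B]).

Definition lipcomp (X : mmspace) (phi : R -> mm_carrier X) : set (R -> R) :=
  [set f \o phi | f in lip1 (X := X)].

Definition dconc (X Y : mmspace) : R :=
  inf [set r : R | exists (phi : R -> mm_carrier X) (psi : R -> mm_carrier Y),
        [/\ parameter phi, parameter psi &
             r = hausdorff dKF (lipcomp phi) (lipcomp psi)]].

Definition box (X Y : mmspace) : R :=
  inf [set e : R | 0 <= e /\
    exists (phi : R -> mm_carrier X) (psi : R -> mm_carrier Y) (I0 : set R),
      [/\ parameter phi /\ parameter psi,
          measurable (I0 : set (measurableTypeR R)), I0 `<=` I01,
          (((1 - e)%R)%:E <= leb I0)%E &
          forall s t, I0 s -> I0 t ->
            `|mm_dist (phi s) (phi t) - mm_dist (psi s) (psi t)| <= e]].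

Definition box_set (X : mmspace) (P : mmspace -> Prop) : R :=
  inf [set r : R | exists2 Y, P Y & r = box X Y].

Definition lip_dom (Y X : mmspace) : Prop :=
  exists f : mm_carrier X -> mm_carrier Y,
    (forall x x', mm_dist (f x) (f x') <= mm_dist x x') /\
    forall B : set (mm_carrier Y), measurable B ->
      mm_measure X (f @^-1` B) = mm_measure Y B.

Definition is_pyramid (P : mmspace -> Prop) : Prop :=
  [/\ exists X, P X,
      (forall X, (forall e : R, 0 < e -> exists2 Y, P Y & box X Y < e) -> P X),
      (forall X Y, P X -> lip_dom Y X -> P Y) &
      (forall Y Y', P Y -> P Y' -> exists2 X, P X & lip_dom Y X /\ lip_dom Y' X)].

Definition pyramid := {P : mmspace -> Prop | is_pyramid P}.

Definition weak_cvg (Pn : nat -> pyramid) (P : pyramid) : Prop :=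
  (forall X, proj1_sig P X ->
     forall e : R, 0 < e -> exists N : nat, forall n, (N <= n)%N ->
       box_set X (proj1_sig (Pn n)) < e) /\
  (forall X, ~ proj1_sig P X ->
     exists2 c : R, 0 < c & exists N : nat, forall n, (N <= n)%N ->
       c <= box_set X (proj1_sig (Pn n))).

Definition conc_open (U : mmspace -> Prop) : Prop := d_open dconc U.

(** weak topology: the topology of a metric compatible with weak
   convergence, i.e. the sequential topology of weak convergence *)
Definition weak_open (U : pyramid -> Prop) : Prop :=
  forall P, U P -> forall Pn : nat -> pyramid, weak_cvg Pn P ->
    exists N : nat, forall n, (N <= n)%N -> U (Pn n).

Definition path_cont (T : Type) (op : (T -> Prop) -> Prop) (g : R -> T) : Prop :=
  forall U, op U -> forall t, 0 <= t <= 1 -> U (g t) ->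
    exists2 dl : R, 0 < dl & forall s, 0 <= s <= 1 -> `|s - t| < dl -> U (g s).

Definition path_connected_set (T : Type) (op : (T -> Prop) -> Prop) (V : T -> Prop) : Prop :=
  forall x y, V x -> V y -> exists g : R -> T,
    [/\ path_cont op g, g 0 = x, g 1 = y & forall t, 0 <= t <= 1 -> V (g t)].

Definition locally_path_connected (T : Type) (op : (T -> Prop) -> Prop) : Prop :=
  forall (x : T) (U : T -> Prop), op U -> U x ->
    exists V : T -> Prop, [/\ op V, V x, (forall y, V y -> U y) & path_connected_set op V].

End Defs.

(* Main.v *)
Require Import Defs.
From HB Require Import structures.
From mathcomp Require Import all_boot all_order all_algebra.
From mathcomp Require Import all_classical all_reals.
From mathcomp Require Import topology normedtype sequences measure lebesgue_measure probability.
From mathcomp Require Import ereal measurable_realfun lebesgue_integral.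
From mathcomp Require Import measurable_fun_approximation ring lra.
Set Implicit Arguments.
Unset Strict Implicit.
Unset Printing Implicit Defensive.
Import numFieldNormedType.Exports.
Import Order.TTheory GRing.Theory Num.Theory.
Local Open Scope classical_set_scope.
Local Open Scope ring_scope.

(** In both spaces it suffices to join every point [z] near [y] to [y] by a path
    that stays near [y]: the path component of [x] in an open set is then open.

    Concentration topology.  Parameters of [Y] and [X] that almost realize
    [dconc Y X] give a measure on [X * Y]; the path is [X * Y] with the metric
    [(1 - t) d_Y + t d_X].  On a cell of a fixed finite net of [Y] every
    1-Lipschitz function of [X] is almost constant, and two cells are at
    [d_X]-distance at most their [d_Y]-distance plus an error; hence the
    interpolating metrics have almost the same 1-Lipschitz functions as [d_Y].

    Weak topology.  Write [D(W, Z) <= e] when the distances of [W] are at most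
    those of [Z] plus [e] off a set of measure [e], along suitable parameters.
    The spaces [W] with [D(W, Z) = 0] form the pyramid of [Z], by a compactness
    argument, and [D(W, Z)] is comparable to the box distance from [W] to it.
    Every pyramid [Q] is exhausted by a sequence that is increasing for the
    Lipschitz order; interpolating metrics along the sequence gives a monotone
    path from the pyramid of its first term to [Q].  If [Q_n] converges to [Q],
    some [Y_n] in [Q_n] is box-close to a term [X_k] of an exhausting sequence of
    [Q].  Descend from [Q_n] to [Y_n], interpolate linearly to [X_k], climb to
    [Q]: the two monotone parts are squeezed between convergent sequences of
    pyramids, and the linear part is box-close to [X_k]. *)

(** * Probability spaces and parameters *)

(** The infima in [box] and [dconc] run over parameters, and two parameters of one space need not
    differ by a map of the interval. To compose two approximations, the parameters of the middle
    space must be coupled; hence the asymmetric relation is transitive only up to an arbitrarily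
    small extra error. One-sided control suffices for pyramids, which are closed and downward
    closed: an almost dominated space can be perturbed into a dominated one.

    Compactness serves the directedness of the spaces dominated by [Z]: two approximate dominations
    must become two maps on [Z] before an upper bound can be formed as an image.

    Paths must end exactly at the given objects, while the interpolated distance degenerates to a
    pseudometric at both ends, so the end spaces are inserted by hand. A general pyramid is not that
    of a single space and is reached only in the limit at time 1. Weak openness is a condition on
    sequences, so continuity of paths and openness of path components are both derived by
    contradiction from a sequence of bad points. *)

Section pr.
Context (R : realType) d (T : measurableType d) (P : probability T R).

Definition pr (A : set T) : R := fine (P A).

Lemma prE (A : set T) : measurable A -> P A = (pr A)%:E.
Proof. by move=> mA; rewrite /pr fineK// fin_num_measure. Qed.

Lemma pr_ge0 (A : set T) : 0 <= pr A.
Proof. by rewrite fine_ge0. Qed.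

Lemma pr0 : pr set0 = 0.
Proof. by rewrite /pr measure0. Qed.

Lemma prT : pr setT = 1.
Proof. by rewrite /pr probability_setT. Qed.

Lemma le_pr (A B : set T) : measurable A -> measurable B -> A `<=` B ->
  pr A <= pr B.
Proof. by move=> mA mB AB; rewrite -lee_fin -!prE// le_measure// inE. Qed.

Lemma pr_le1 (A : set T) : measurable A -> pr A <= 1.
Proof. by move=> mA; rewrite -prT le_pr. Qed.

Lemma prC (A : set T) : measurable A -> pr (~` A) = 1 - pr A.
Proof.
move=> mA; apply: EFin_inj; rewrite -prE; last exact: measurableC.
by rewrite probability_setC// prE.
Qed.

Lemma prU (A B : set T) : measurable A -> measurable B ->
  pr (A `|` B) <= pr A + pr B.
Proof.
move=> mA mB; rewrite -lee_fin EFinD -!prE//; last exact: measurableU.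
exact: measureU2.
Qed.

Lemma prU_disj (A B : set T) : measurable A -> measurable B -> A `&` B = set0 ->
  pr (A `|` B) = pr A + pr B.
Proof.
move=> mA mB AB; apply: EFin_inj; rewrite EFinD -!prE//; last exact: measurableU.
exact: measureU.
Qed.

Lemma prI_ge (A B : set T) (a b : R) : measurable A -> measurable B ->
  1 - a <= pr A -> 1 - b <= pr B -> 1 - (a + b) <= pr (A `&` B).
Proof.
move=> mA mB Aa Bb.
have := prU (measurableC mA) (measurableC mB).
rewrite -setCI !prC//; last exact: measurableI.
lra.
Qed.

Lemma pr_bigcup_approx (F : (set T)^nat) (e : R) : (forall n, measurable (F n)) ->
  {homo F : n m / (n <= m)%N >-> n `<=` m} -> 0 < e ->
  exists n, pr (\bigcup_k F k) - e < pr (F n).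
Proof.
move=> mF ndF e0.
have mU : measurable (\bigcup_k F k) by exact: bigcupT_measurable.
have : P \o F @ \oo --> P (\bigcup_k F k).
  by apply: nondecreasing_cvg_mu => // n m nm; apply/subsetPset; exact: ndF.
rewrite prE// => /fine_cvgP[_ /cvgrPdist_lt /(_ _ e0)[n _ /(_ n (leqnn n))/=]].
rewrite -/(pr (F n)) => H; exists n; rewrite ltrBlDr -ltrBlDl.
exact: le_lt_trans (ler_norm _) H.
Qed.

Lemma pr_full_bigcup (F : (set T)^nat) (e : R) : (forall n, measurable (F n)) ->
  {homo F : n m / (n <= m)%N >-> n `<=` m} -> \bigcup_k F k = setT -> 0 < e ->
  exists n, 1 - e < pr (F n).
Proof.
by move=> mF ndF FT e0; have := pr_bigcup_approx mF ndF e0; rewrite FT prT.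
Qed.

Lemma pr_bigcup0 (F : (set T)^nat) : (forall n, measurable (F n)) ->
  (forall n, pr (F n) = 0) -> pr (\bigcup_n F n) = 0.
Proof.
move=> mF F0; rewrite /pr.
suff -> : P (\bigcup_n F n) = 0%E by [].
apply: measure_negligible; first exact: bigcupT_measurable.
apply: negligible_bigcup => n; exists (F n); split => //.
by have := prE (mF n); rewrite F0.
Qed.

Lemma pr_bigcap1 (F : (set T)^nat) : (forall n, measurable (F n)) ->
  (forall n, pr (F n) = 1) -> pr (\bigcap_n F n) = 1.
Proof.
move=> mF F1.
have mC n : measurable (~` F n) by exact: measurableC.
have : pr (~` \bigcap_n F n) = 0.
  rewrite setC_bigcap; apply: pr_bigcup0 => // n.
  by rewrite prC// F1 subrr.
by rewrite prC; [move/eqP; rewrite subr_eq0 => /eqP <-|exact: bigcapT_measurable].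
Qed.

Lemma pr_neq0 (A : set T) : 0 < pr A -> A !=set0.
Proof. by move=> A0; apply/set0P/eqP => A_; move: A0; rewrite A_ pr0 ltxx. Qed.

End pr.

Lemma measurable_cst_set d (T : measurableType d) (Q : Prop) :
  measurable [set _ : T | Q].
Proof.
have [h|h] := pselect Q.
  have -> : [set _ : T | Q] = setT by apply/seteqP; split.
  exact: measurableT.
have -> : [set _ : T | Q] = set0 by apply/seteqP; split.
exact: measurable0.
Qed.

Section unif.
Variable R : realType.
Notation TR := (measurableTypeR R).

Lemma measurable_I01 : measurable (I01 (R := R) : set TR).
Proof. exact: measurable_itv. Qed.

(** The uniform law of the interval lives on the whole line, so that parameters can be taken as
    total measurable maps with a prescribed law. *)
Definition unif0 : set TR -> \bar R := mrestr (@lebesgue_measure R) measurable_I01.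

HB.instance Definition _ := Measure.on unif0.

Lemma unif0T : unif0 setT = 1%E.
Proof. 
by rewrite /unif0 /mrestr setTI lebesgue_measure_itv/= lte_fin ltr01 oppr0 adde0.
Qed.

HB.instance Definition _ := Measure_isProbability.Build _ _ _ unif0 unif0T.

Definition unif : probability TR R := unif0.

Lemma unif_leb (A : set TR) : unif A = leb (I01 (R := R) `&` A).
Proof. by rewrite /unif /= /unif0 /mrestr setIC. Qed.

Lemma unif_I01 : pr unif (I01 (R := R)) = 1.
Proof.
have := unif0T; rewrite /pr -[in X in X -> _]/(unif setT) !unif_leb setIT setIid.
by move=> ->.
Qed.

(** Precomposition with this map makes a map that is measurable on [I01] measurable on the line and
    leaves its values on [I01] unchanged. *)
Definition clamp (s : R) : R := if 0 <= s < 1 then s else 0.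

Lemma clampE s : I01 s -> clamp s = s.
Proof. by rewrite /I01 /= in_itv/= /clamp => ->. Qed.

Lemma measurable_clamp_comp d (T : measurableType d) (f : R -> T) :
  measurable_fun (I01 (R := R) : set TR) f ->
  measurable_fun [set: TR] (f \o clamp).
Proof.
move=> mf _ B mB; rewrite setTI.
have mf' := mf measurable_I01 B mB.
have -> : (f \o clamp) @^-1` B =
  (I01 (R := R) `&` f @^-1` B) `|` (~` I01 (R := R) `&` [set s | B (f 0)]).
  apply/seteqP; split => s /=.
    have [sI|sI] := pselect (I01 s).
      by rewrite (clampE sI) => Bs; left.
    by rewrite /clamp ifF; [right|apply/negP => h; apply: sI; rewrite /I01/= in_itv/=].
  move=> [[sI ?]|[sI ?]]; first by rewrite (clampE sI).
  by rewrite /clamp ifF //; apply/negP => h; apply: sI; rewrite /I01/= in_itv/=.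
apply: measurableU; first exact: mf'.
apply: measurableI; first by apply: measurableC; exact: measurable_I01.
exact: measurable_cst_set.
Qed.

Definition law d (T : measurableType d) (P : probability T R) (f : R -> T) :=
  measurable_fun [set: TR] f /\ forall B, measurable B -> unif (f @^-1` B) = P B.

Lemma law_meas d (T : measurableType d) (P : probability T R) (f : R -> T) B :
  law P f -> measurable B -> measurable (f @^-1` B : set TR).
Proof. by move=> [mf _] mB; rewrite -[X in measurable X]setTI; exact: mf. Qed.

Lemma law_pr d (T : measurableType d) (P : probability T R) (f : R -> T) B :
  law P f -> measurable B -> pr unif (f @^-1` B) = pr P B.
Proof. by move=> [mf h] mB; rewrite /pr h. Qed.

Definition tparam (X : mmspace R) (phi : R -> mm_carrier X) :=
  law (mm_measure X) phi.

Lemma tparam_param (X : mmspace R) (phi : R -> mm_carrier X) :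
  tparam phi -> parameter phi.
Proof.
move=> [mf h]; split; first exact: measurable_funTS.
by move=> B mB; rewrite -unif_leb h.
Qed.

Lemma param_tparam (X : mmspace R) (phi : R -> mm_carrier X) :
  parameter phi -> tparam (phi \o clamp).
Proof.
move=> [mf h]; split; first exact: measurable_clamp_comp.
move=> B mB; rewrite -h// unif_leb; congr (leb _).
by apply/seteqP; split=> s /= [sI]; rewrite (clampE sI).
Qed.

End unif.

(** * Constructions of mm-spaces *)

Section metric_facts.
Context (R : realType) (X : mmspace R).
Notation d := (@mm_dist R X).

Lemma mmd_ge0 x y : 0 <= d x y. Proof. by case: (mm_metric X). Qed.
Lemma mmdxx x : d x x = 0. Proof. by case: (mm_metric X) => _ h _ _; apply/h. Qed.
Lemma mmd_eq0 x y : d x y = 0 -> x = y.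
Proof. by case: (mm_metric X) => _ h _ _ /h. Qed.
Lemma mmdC x y : d x y = d y x. Proof. by case: (mm_metric X). Qed.
Lemma mmd_tri x y z : d x z <= d x y + d y z. Proof. by case: (mm_metric X). Qed.

Lemma mmd_lip x y z : `|d x y - d x z| <= d y z.
Proof.
have := mmd_tri x y z; have := mmd_tri x z y; rewrite (mmdC z y) => h1 h2.
by rewrite ler_norml; apply/andP; split; lra.
Qed.

Lemma mmd_lip2 x y x' y' : `|d x y - d x' y'| <= d x x' + d y y'.
Proof.
have := mmd_tri x x' y; have := mmd_tri x' y' y; have := mmd_tri x' x y'.
have := mmd_tri x y y'; rewrite (mmdC y' y) (mmdC x' x) => *.
by rewrite ler_norml; apply/andP; split; lra.
Qed.

Lemma mm_inhab : mm_carrier X.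
Proof. by have /cid[s _] := mm_separable X; exact: s 0%N. Qed.

Lemma d_open_measurable (U : set (mm_carrier X)) : d_open d U -> measurable U.
Proof. by rewrite mm_borel => oU; exact: sub_sigma_algebra. Qed.

Definition oball x (r : R) : set (mm_carrier X) := [set y | d x y < r].

Lemma oball_open x r : d_open d (oball x r).
Proof.
move=> y; rewrite /oball /= => xy; exists (r - d x y); first by rewrite subr_gt0.
move=> z yz; have := mmd_tri x y z; lra.
Qed.

Lemma oball_measurable x r : measurable (oball x r).
Proof. exact/d_open_measurable/oball_open. Qed.

Lemma mm_measurable_fun d' (T : measurableType d') (f : T -> mm_carrier X) :
  (forall U : set (mm_carrier X), d_open d U -> measurable (f @^-1` U)) ->
  measurable_fun setT f.
Proof.
move=> h; apply: (measurability (d_open d)); first exact: mm_borel.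
by move=> _ [U oU <-]; rewrite setTI; exact: h.
Qed.

Lemma lip1_measurable (f : mm_carrier X -> R) : lip1 f ->
  measurable_fun setT (f : _ -> measurableTypeR R).
Proof.
move=> lf; apply: (measurability _ (RGenOpens.measurableE R)).
move=> _ [_ [a [b ->]] <-]; rewrite setTI; apply: d_open_measurable => x /=.
rewrite in_itv/= => /andP[ax xb].
exists (Num.min (f x - a) (b - f x)); first by rewrite lt_min !subr_gt0 ax.
move=> y; rewrite lt_min => /andP[h1 h2]; have := lf x y.
by rewrite in_itv/= ler_norml => /andP[h3 h4]; apply/andP; split; lra.
Qed.

Lemma lip1_dist x : lip1 (fun y : mm_carrier X => d x y).
Proof. by move=> y z; exact: mmd_lip. Qed.

Lemma finite_net (r e : R) : 0 < r -> 0 < e ->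
  exists s : nat -> mm_carrier X, exists N : nat,
    1 - e < pr (mm_measure X) [set x | exists2 i, (i < N)%N & d (s i) x < r].
Proof.
move=> r0 e0; have [s hs] := mm_separable X; exists s.
pose F N := [set x | exists2 i, (i < N)%N & d (s i) x < r].
have mF N : measurable (F N).
  apply: d_open_measurable => x [i iN ix].
  have [e' e'0 he'] := @oball_open (s i) r x ix.
  by exists e' => // y xy; exists i => //; exact: he'.
apply: (@pr_full_bigcup _ _ _ (mm_measure X) F) => //.
  by move=> n m nm x [i iN ix]; exists i => //; exact: leq_trans nm.
apply/seteqP; split => // x _; have [n hn] := hs x r r0.
by exists n.+1 => //; exists n => //; rewrite mmdC.
Qed.

End metric_facts.

Lemma nonexpansive_measurable (R : realType) (X Y : mmspace R)
    (f : mm_carrier X -> mm_carrier Y) :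
  (forall x x', mm_dist (f x) (f x') <= mm_dist x x') -> measurable_fun setT f.
Proof.
move=> lf; apply: mm_measurable_fun => U oU; apply: d_open_measurable => x Ux.
have [e e0 he] := oU _ Ux; exists e => // y xy; apply: he.
exact: le_lt_trans (lf _ _) xy.
Qed.

(** McShane extension with an error: the function is the infimum over [k] in [K] of
    [h k + mm_dist (psi k) x]. It is 1-Lipschitz as an infimum of such functions, [k = s] gives the
    upper bound, and the hypothesis gives the lower one. *)
Lemma mcshane (R : realType) (X : mmspace R) (S : Type) (K : set S)
    (psi : S -> mm_carrier X) (h : S -> R) (e : R) :
  (forall s t, K s -> K t -> h s - h t <= mm_dist (psi s) (psi t) + e) ->
  exists2 f : mm_carrier X -> R, lip1 f &
    forall s, K s -> h s - e <= f (psi s) <= h s.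
Proof.
move=> hK; have [[k0 Kk0]|K0] := pselect (K !=set0); last first.
  exists (fun=> 0); first by move=> x y; rewrite subrr normr0 mmd_ge0.
  by move=> s Ks; exfalso; apply: K0; exists s.
pose A x := [set h k + mm_dist (psi k) x | k in K].
have lbA x k : K k -> lbound (A x) (h k - e - mm_dist (psi k) x).
  move=> Kk _ [k' Kk' <-]; have := hK _ _ Kk Kk'.
  have := mmd_tri (psi k) x (psi k'); rewrite (mmdC x (psi k')); lra.
have neA x : A x !=set0 by exists (h k0 + mm_dist (psi k0) x); exists k0.
have hlb x : has_lbound (A x) by exists (h k0 - e - mm_dist (psi k0) x); exact: lbA.
have half x y : inf (A x) - inf (A y) <= mm_dist x y.
  rewrite lerBlDr addrC -lerBlDr; apply: lb_le_inf => // _ [k Kk <-].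
  rewrite lerBlDr; apply: (le_trans (ge_inf (hlb x) _)); first by exists k.
  by rewrite -addrA lerD2l (mmdC x y); exact: mmd_tri.
exists (fun x => inf (A x)).
  by move=> x y; rewrite ler_norml lerNl opprB half mmdC half.
move=> s Ks; apply/andP; split.
  by apply: lb_le_inf => //; have := lbA (psi s) s Ks; rewrite mmdxx subr0.
by apply: ge_inf => //; exists s => //; rewrite mmdxx addr0.
Qed.

Section remetric.
Context (R : realType) (Z : mmspace R).
Variables (d' : mm_carrier Z -> mm_carrier Z -> R) (tau : R).
Hypotheses (d'm : is_metric d') (tau0 : 0 < tau).
Hypothesis d'l : forall x y, tau * Num.min (mm_dist x y) 1 <= d' x y.
Hypothesis d'u : forall x y, d' x y <= mm_dist x y.

Let small (e : R) : 0 < e -> exists2 e' : R, 0 < e' &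
  forall x y, d' x y < e' -> mm_dist x y < e.
Proof.
move=> e0; exists (tau * Num.min e 1); first by rewrite mulr_gt0// lt_min e0 ltr01.
move=> x y /(le_lt_trans (d'l x y)); rewrite ltr_pM2l// lt_min => /andP[].
by rewrite !gt_min ltxx orbF => /orP[//|h] /lt_trans; apply.
Qed.

Lemma remetric_open U : d_open d' U <-> d_open (@mm_dist R Z) U.
Proof.
split=> oU x Ux; have [e e0 he] := oU x Ux.
  by exists e => // y xy; apply: he; exact: le_lt_trans (d'u x y) xy.
by have [e' e'0 he'] := small e0; exists e' => // y /he'; exact: he.
Qed.

Let d'complete : d_complete d'.
Proof.
move=> u cu; have [|x hx] := @mm_complete R Z u.
  move=> e /small[e' e'0 he']; have [N hN] := cu _ e'0.
  by exists N => m n Nm Nn; apply: he'; exact: hN.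
exists x => e e0; have [N hN] := hx e e0; exists N => n Nn.
exact: le_lt_trans (d'u _ _) (hN _ Nn).
Qed.

Let d'separable : d_separable d'.
Proof.
have [s hs] := mm_separable Z; exists s => x e e0; have [n hn] := hs x e e0.
by exists n; exact: le_lt_trans (d'u _ _) hn.
Qed.

Let d'borel : @measurable _ (mm_carrier Z) = <<s d_open d' >>.
Proof.
rewrite mm_borel; congr (<<s _ >>); apply/seteqP; split=> U /remetric_open//.
Qed.

(** A metric between [tau * min(d, 1)] and [d] has the same open sets and Cauchy sequences as [d],
    so only the distance changes. All modified metrics of the proof are introduced this way. *)
Definition remetric : mmspace R :=
  MMSpace d'm d'complete d'separable d'borel (mm_measure Z).

End remetric.

Section mmprod.
Context (R : realType) (X Y : mmspace R).
Notation T := (mm_carrier X * mm_carrier Y)%type.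

Definition dsum (p q : T) : R := mm_dist p.1 q.1 + mm_dist p.2 q.2.

Lemma dsum_metric : is_metric dsum.
Proof.
split.
- by move=> *; rewrite addr_ge0// mmd_ge0.
- move=> [x y] [x' y']; split => [/eqP|[-> ->]]; last by rewrite /dsum !mmdxx addr0.
  by rewrite paddr_eq0 ?mmd_ge0//= => /andP[/eqP/mmd_eq0 -> /eqP/mmd_eq0 ->].
- by move=> p q; rewrite /dsum mmdC (mmdC p.2).
- move=> p q r; rewrite /dsum; have := mmd_tri p.1 q.1 r.1.
  have := mmd_tri p.2 q.2 r.2; lra.
Qed.

Lemma dsum_complete : d_complete dsum.
Proof.
move=> u cu.
have [|x hx] := @mm_complete R X (fst \o u).
  move=> e /cu[N hN]; exists N => m n Nm Nn; apply: le_lt_trans (hN _ _ Nm Nn).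
  by rewrite lerDl mmd_ge0.
have [|y hy] := @mm_complete R Y (snd \o u).
  move=> e /cu[N hN]; exists N => m n Nm Nn; apply: le_lt_trans (hN _ _ Nm Nn).
  by rewrite lerDr mmd_ge0.
exists (x, y) => e e0; have e20 : 0 < e / 2 by rewrite divr_gt0.
have [N hN] := hx _ e20; have [M hM] := hy _ e20.
exists (maxn N M) => n; rewrite geq_max => /andP[/hN h1 /hM h2].
by rewrite /dsum/= (splitr e) ltrD.
Qed.

Lemma dsum_separable : d_separable dsum.
Proof.
have [s hs] := mm_separable X; have [t ht] := mm_separable Y.
exists (fun n => let p := odflt (0%N, 0%N) (unpickle n) in (s p.1, t p.2)).
move=> [x y] e e0; have e20 : 0 < e / 2 by rewrite divr_gt0.
have [n hn] := hs x _ e20; have [m hm] := ht y _ e20.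
by exists (pickle (n, m)); rewrite pickleK/= /dsum/= (splitr e) ltrD.
Qed.

Lemma dsum_borel : @measurable _ T = <<s d_open dsum >>.
Proof.
have hX : measurable_fun setT (fst : g_sigma_algebraType (d_open dsum) -> mm_carrier X).
  apply: mm_measurable_fun => U oU; apply: sub_sigma_algebra => p Up.
  have [e e0 he] := oU _ Up; exists e => // q pq; apply: he.
  by apply: le_lt_trans pq; rewrite lerDl mmd_ge0.
have hY : measurable_fun setT (snd : g_sigma_algebraType (d_open dsum) -> mm_carrier Y).
  apply: mm_measurable_fun => U oU; apply: sub_sigma_algebra => p Up.
  have [e e0 he] := oU _ Up; exists e => // q pq; apply: he.
  by apply: le_lt_trans pq; rewrite lerDr mmd_ge0.
apply/seteqP; split.
  have h : measurable_fun setT (id : g_sigma_algebraType (d_open dsum) -> T).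
    by apply/measurable_fun_pairP; split; [exact: hX|exact: hY].
  by move=> A mA; have := h measurableT A mA; rewrite setTI.
apply: smallest_sub; first exact: sigma_algebra_measurable.
move=> U oU.
have [s hs] := mm_separable X; have [t ht] := mm_separable Y.
pose B (i j k : nat) : set T := oball (s i) (k.+1%:R^-1) `*` oball (t j) (k.+1%:R^-1).
(* Products of balls from a countable base; those not contained in [U] are replaced by the empty
   set, so that the union over all codes is [U]. *)
pose C (n : nat) : set T := let: (i, j, k) := odflt (0, 0, 0)%N (unpickle n) in
  if `[< B i j k `<=` U >] then B i j k else set0.
have -> : U = \bigcup_n C n.
  apply/seteqP; split; last first.
    move=> p [n _]; rewrite /C; case: (odflt _ _) => -[i j] k.
    by case: asboolP => // BU /BU.
  move=> p Up; have [e e0 he] := oU _ Up.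
  have [k hk] : exists k : nat, k.+1%:R^-1 < e / 4.
    have : 0 < e / 4 by rewrite divr_gt0.
    by move=> /ltr_add_invr[k]; rewrite add0r => ?; exists k.
  have k0 : 0 < k.+1%:R^-1 :> R by rewrite invr_gt0.
  have [i hi] := hs p.1 _ k0; have [j hj] := ht p.2 _ k0.
  have BU : B i j k `<=` U.
    move=> q [q1 q2]; apply: he; rewrite /dsum.
    have := mmd_tri p.1 (s i) q.1; have := mmd_tri p.2 (t j) q.2.
    move: q1 q2; rewrite /oball/=; move: hi hj hk; set r := _^-1; lra.
  exists (pickle (i, j, k)) => //.
  have -> : C (pickle (i, j, k)) = B i j k by rewrite /C pickleK /= asboolT.
  by split; rewrite /oball/= mmdC.
apply: bigcupT_measurable => n; rewrite /C; case: (odflt _ _) => -[i j] k.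
case: asboolP => // _; apply: measurableX; exact: oball_measurable.
Qed.

Definition mmprod (P : probability T R) : mmspace R :=
  MMSpace dsum_metric dsum_complete dsum_separable dsum_borel P.

End mmprod.

Section image_law.
Context (R : realType) d d' (T : measurableType d) (T' : measurableType d').
Variables (P : probability T R) (f : T -> T') (mf : measurable_fun setT f).


Let mfunf : {mfun T >-> T'} := HB.pack f (isMeasurableFun.Build _ _ _ _ f mf).

Definition image_law : probability T' R := distribution P mfunf.

Lemma image_lawE A : image_law A = P (f @^-1` A).
Proof. by []. Qed.

End image_law.

Section pairing.
Context (R : realType) (X Y : mmspace R).
Variables (phi : R -> mm_carrier X) (psi : R -> mm_carrier Y).
Hypotheses (hphi : tparam phi) (hpsi : tparam psi).
Notation TR := (measurableTypeR R).

Definition pairing (s : R) := (phi s, psi s).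

Lemma measurable_pairing : measurable_fun [set: TR] pairing.
Proof. by apply: measurable_fun_pair; [case: hphi|case: hpsi]. Qed.

Definition mmpair : mmspace R := mmprod (image_law (unif R) measurable_pairing).

Lemma pairing_tparam : @tparam R mmpair pairing.
Proof. by split=> //; exact: measurable_pairing. Qed.

End pairing.

(** * Existence of parameters *)

Section quantile.
Variable R : realType.
Notation TR := (measurableTypeR R).

Lemma pr_unif_tail (a : R) : 0 <= a <= 1 -> pr (unif R) (`[a, 1[%classic : set TR) = 1 - a.
Proof.
move=> /andP[a0 a1]; rewrite /pr unif_leb setIidr; last first.
  by move=> u; rewrite /I01/= !in_itv/= => /andP[/(le_trans a0) -> ->].
rewrite /leb lebesgue_measure_itv/= lte_fin; case: ifPn => // /negP h.
suff -> : a = 1 by rewrite subrr.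
by apply/eqP; rewrite eq_le a1 leNgt; apply/negP.
Qed.

(** Quantile transform: [q0 u] is the infimum of the [r] with [u < F r], for the distribution
    function [F] of [nu]. It is monotone, hence Borel, and its law agrees with [nu] on the rays []r,
    +oo[], which form a generating pi-system. *)
Lemma quantile_law (nu : probability TR R) :
  pr nu (`[0, 1]%classic : set TR) = 1 -> exists q : R -> TR, law nu q.
Proof.
move=> nu01.
pose ray (r : R) : set TR := `]r, +oo[%classic.
have mray r : measurable (ray r) by exact: measurable_itv.
pose F r := 1 - pr nu (ray r).
have Fmono r r' : r <= r' -> F r <= F r'.
  move=> rr'; rewrite lerD2l lerN2 le_pr// => x.
  by rewrite /ray/= !in_itv/= !andbT; exact: le_lt_trans.
have F1 : F 1 = 1.
  rewrite /F; suff -> : pr nu (ray 1) = 0 by rewrite subr0.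
  apply/eqP; rewrite eq_le pr_ge0 andbT.
  have := prC nu (measurable_itv `[0, 1]); rewrite nu01 subrr => <-.
  apply: le_pr => //; first by apply: measurableC; exact: measurable_itv.
  by move=> x; rewrite /ray/= !in_itv/= andbT => x1 /andP[_]; rewrite leNgt x1.
have Fneg r : r < 0 -> F r = 0.
  move=> r0; rewrite /F; apply/eqP; rewrite subr_eq0 eq_sym eq_le pr_le1//=.
  rewrite -nu01; apply: le_pr => //.
  by move=> x; rewrite /ray/= !in_itv/= andbT => /andP[+ _]; exact: lt_le_trans.
have F01 r : 0 <= F r <= 1.
  by rewrite /F subr_ge0 pr_le1//= gerBl pr_ge0.
(* Right continuity of [F]. The strict inequality [r < q0 u] follows from [F r' <= u] for some
   [r' > r], but not from [F r <= u]. *)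
have Frc r e : 0 < e -> exists2 r', r < r' & F r' < F r + e.
  move=> e0; pose G n := ray (r + n.+1%:R^-1).
  have mG n : measurable (G n) by exact: mray.
  have ndG : {homo G : n m / (n <= m)%N >-> n `<=` m}.
    move=> n m nm x; rewrite /G /ray/= !in_itv/= !andbT; apply: le_lt_trans.
    by rewrite lerD2l lef_pV2 ?posrE// ler_nat.
  have [n hn] := pr_bigcup_approx nu mG ndG e0.
  exists (r + n.+1%:R^-1); first by rewrite ltrDl.
  have GU : \bigcup_k G k = ray r.
    apply/seteqP; split=> [x [k _]|x]; rewrite /G /ray/= !in_itv/= !andbT.
      by apply: lt_trans; rewrite ltrDl.
    by move=> /ltr_add_invr[k hk]; exists k => //; rewrite /= in_itv/= hk.
  by move: hn; rewrite GU /F /G; lra.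
pose S (u : R) : set R := [set r | u < F r].
have S1 u : I01 u -> S u 1 by rewrite /I01/= in_itv/= /S /= F1 => /andP[].
have Slb u : I01 u -> lbound (S u) 0.
  rewrite /I01/= in_itv/= => /andP[u0 _] r /= Sr; rewrite leNgt; apply/negP => r0.
  by move: Sr; rewrite /S/= Fneg// ltNge u0.
pose q0 (u : R) : TR := inf (S u).
have q0mono u v : I01 u -> I01 v -> u <= v -> q0 u <= q0 v.
  move=> Iu Iv uv; apply: lb_le_inf; first by exists 1; exact: S1.
  move=> r Sr; apply: ge_inf; first by exists 0; exact: Slb.
  exact: le_lt_trans uv Sr.
have mq0 : measurable_fun (I01 (R := R) : set TR) q0.
  apply: (measurability _ (RGenOInfty.measurableE R)) => _ [_ [r ->] <-].
  apply: is_interval_measurable => u v [Iu +] [Iv _] w /andP[uw wv].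
  rewrite /= !in_itv/= !andbT => ru.
  have Iw : I01 w.
    move: Iu Iv; rewrite /I01/= !in_itv/= => /andP[u0 _] /andP[_ v1].
    by rewrite (le_trans u0 uw) (le_lt_trans wv v1).
  by split => //; rewrite /= ?in_itv/= ?andbT (lt_le_trans ru)// q0mono.
have mq := measurable_clamp_comp mq0.
exists (q0 \o @clamp R); split=> // B mB.
rewrite -(image_lawE (unif R) mq).
apply: (@measure_unique _ R TR (RGenOInfty.G (R := R)) (fun n => ray (- n%:R))
  _ _ _ _ (image_law (unif R) mq) nu) => //.
- exact: RGenOInfty.measurableE.
- move=> _ _ [a ->] [b ->]; exists (Num.max a b).
  by apply/seteqP; split=> x /=; rewrite !in_itv/= !andbT gt_max; [move=> [-> ->]|move=> /andP[]].
- by move=> n; exists (- n%:R).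
- apply/seteqP; split=> // x _; exists (Num.truncn `|x|).+1 => //.
  rewrite /ray/= in_itv/= andbT ltrNl; apply: le_lt_trans (truncnS_gt _).
  by rewrite -normrN ler_norm.
- move=> _ [r ->].
  change (unif R ((q0 \o @clamp R) @^-1` ray r) = nu (ray r)).
  have mp : measurable ((q0 \o @clamp R) @^-1` ray r : set TR).
    by rewrite -[X in measurable X]setTI; exact: mq.
  rewrite !prE//; congr EFin.
  have -> : pr nu (ray r) = 1 - F r by rewrite /F opprB addrC subrK.
  apply/eqP; rewrite eq_le; apply/andP; split.
    rewrite -pr_unif_tail//.
    have := prU (unif R) (measurableC (@measurable_I01 R)) (measurable_itv `[F r, 1[).
    have : pr (unif R) ((q0 \o @clamp R) @^-1` ray r) <=
       pr (unif R) (~` I01 (R := R) `|` `[F r, 1[).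
      apply: le_pr => //.
        apply: measurableU; last exact: measurable_itv.
        by apply: measurableC; exact: measurable_I01.
      move=> u; have [Iu|] := pselect (I01 u); last by move=> ? _; left.
      rewrite /= (clampE Iu) /ray/= in_itv/= andbT => ru; right.
      move: (Iu); rewrite /I01/= !in_itv/= => /andP[_ ->]; rewrite andbT leNgt.
      apply/negP => uF; move: ru; rewrite ltNge => /negP; apply.
      by apply: ge_inf => //; exists 0; exact: Slb.
    rewrite prC; last exact: measurable_I01.
    by rewrite unif_I01; lra.
  apply/ler_addgt0Pr => e e0; have [r' rr' hr'] := Frc r _ e0.
  apply: (@le_trans _ _ (1 - F r' + e)); first lra.
  rewrite lerD2r -pr_unif_tail//; apply: le_pr => //.
  move=> u; rewrite /= in_itv/= => /andP[uF u1].
  have Iu : I01 u.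
    by rewrite /I01/= in_itv/= u1 andbT (le_trans _ uF)//; case/andP: (F01 r').
  rewrite (clampE Iu) /ray/= in_itv/= andbT (lt_le_trans rr')//.
  apply: lb_le_inf; first by exists 1; exact: S1.
  move=> x; rewrite /S/= => ux; rewrite leNgt; apply/negP => xr'.
  by have := Fmono _ _ (ltW xr'); rewrite leNgt (le_lt_trans uF ux).
- move=> k; apply: (le_lt_trans (probability_le1 _ _)); last exact: ltry.
  exact: mray.
Qed.

End quantile.

(** * The Cantor code of a binary sequence *)

Section ternary.
Variable R : realType.

(** Base three with digits 0 and 2: a sequence starting with 0 has value at most 1/3, one starting
    with 1 has value at least 2/3. Comparison with 1/2 thus recovers the digit, without the
    ambiguity of binary expansions. *)
Definition tern (b : nat -> bool) (n : nat) : R :=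
  \sum_(i < n) (b i)%:R * (2 / 3 ^+ i.+1).

Lemma ternS b n : tern b n.+1 = ((b 0%N)%:R * 2 + tern (fun i => b i.+1) n) / 3.
Proof.
rewrite /tern big_ord_recl/= [in RHS]mulrDl mulr_suml; congr (_ + _); first by rewrite expr1; field.
apply: eq_bigr => i _; rewrite /bump/= [in LHS]exprS invfM.
by field; rewrite expf_neq0// pnatr_eq0.
Qed.

Lemma tern_nd b : nondecreasing_seq (tern b).
Proof.
apply/nondecreasing_seqP => n; rewrite /tern big_ord_recr/= lerDl.
by rewrite mulr_ge0// divr_ge0// exprn_ge0.
Qed.

Lemma tern_le1 b n : 0 <= tern b n <= 1.
Proof.
elim: n b => [|n IH] b; first by rewrite /tern big_ord0 lexx ler01.
have /andP[h0 h1] := IH (fun i => b i.+1).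
by rewrite ternS; case: (b 0%N) => /=; apply/andP; split; lra.
Qed.

Lemma tern_is_cvg b : cvgn (tern b).
Proof.
apply: nondecreasing_is_cvgn; first exact: tern_nd.
by exists 1 => _ [n _ <-]; case/andP: (tern_le1 b n).
Qed.

Definition ternlim b : R := limn (tern b).

Lemma ternlimS b : ternlim b = ((b 0%N)%:R * 2 + ternlim (fun i => b i.+1)) / 3.
Proof.
apply/cvg_lim => //; rewrite -(cvg_shiftS (tern b)) /=.
under eq_cvg do rewrite ternS.
by apply: cvgMl; apply: cvgD; [exact: cvg_cst|exact: tern_is_cvg].
Qed.

Lemma ternlim01 b : 0 <= ternlim b <= 1.
Proof.
apply/andP; split.
  by apply: limr_ge; [exact: tern_is_cvg|apply: nearW => n; case/andP: (tern_le1 b n)].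
by apply: limr_le; [exact: tern_is_cvg|apply: nearW => n; case/andP: (tern_le1 b n)].
Qed.

(** Iterates the expanding map that drops the leading digit. It is a Borel function, so every digit
    can be read off in a Borel way. *)
Fixpoint ternrem (n : nat) (r : R) : R :=
  if n is n'.+1 then ternrem n' (if 1 / 2 < r then 3 * r - 2 else 3 * r) else r.

Lemma ternrem_lim n b : (1 / 2 < ternrem n (ternlim b)) = b n.
Proof.
have dig c : (1 / 2 < ternlim c) = c 0%N.
  have /andP[h0 h1] := ternlim01 (fun i => c i.+1).
  rewrite ternlimS; case: (c 0%N) => /=; first by apply/idP; lra.
  by apply/negbTE; rewrite -leNgt; lra.
elim: n b => [|n IH] b //=; rewrite dig -(IH (fun i => b i.+1)).
congr (_ < ternrem _ _); rewrite (ternlimS b); case: (b 0%N) => /=; lra.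
Qed.

Lemma measurable_ternrem n :
  measurable_fun setT (ternrem n : measurableTypeR R -> measurableTypeR R).
Proof.
elim: n => [|n IH]; first exact: measurable_id.
apply: (measurableT_comp IH).
apply: measurable_fun_ifT => //=.
  exact: measurable_fun_ltr.
have := @measurable_funB _ (measurableTypeR R) R setT (fun t : R => 3 * t) (fun => 2).
by apply; [exact: measurable_funM|exact: measurable_cst].
Qed.

End ternary.

(** * Every mm-space has a parameter *)

Section param_exists.
Context (R : realType) (X : mmspace R).
Notation TR := (measurableTypeR R).

(* [D n i r] reads: the point coded by [r] is within [1/(n+1)] of [s i]. *)
Lemma decode_measurable (s : nat -> mm_carrier X) (D : nat -> nat -> set TR) :
  (forall n i, measurable (D n i)) ->
  exists2 g : TR -> mm_carrier X, measurable_fun setT g &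
    forall r x, (forall n, exists i, D n i r) ->
      (forall n i, D n i r -> mm_dist (s i) x < n.+1%:R^-1) -> g r = x.
Proof.
move=> mD.
(* Keeping the least admissible [i] makes the ball read off at each scale unique. *)
pose A n i : set TR := D n i `\` \bigcup_(j in [set j | (j < i)%N]) D n j.
have mA n i : measurable (A n i).
  by apply: measurableD => //; apply: bigcup_measurable.
have Auniq n i j r : A n i r -> A n j r -> i = j.
  move=> [Di hi] [Dj hj]; case: (ltngtP i j) => // ij; exfalso.
    by apply: hj; exists i.
  by apply: hi; exists j.
pose near r y := forall n, exists2 i, A n i r & mm_dist (s i) y <= n.+1%:R^-1.
have near_dist r y n i : near r y -> A n i r -> mm_dist (s i) y <= n.+1%:R^-1.
  by move=> ry Ai; have [j Aj] := ry n; rewrite (Auniq _ _ _ _ Aj Ai).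
have small (e : R) : 0 < e -> exists n : nat, n.+1%:R^-1 < e.
  by move=> /ltr_add_invr[k]; rewrite add0r => ?; exists k.
have near_uniq r y z : near r y -> near r z -> y = z.
  move=> ry rz; apply: mmd_eq0; apply/eqP; rewrite eq_le mmd_ge0 andbT.
  apply/ler_addgt0Pr => e e0; have [n hn] := small (e / 2) (divr_gt0 e0 (ltr0Sn _ _)).
  have [i Ai hi] := ry n; have [j Aj] := rz n; rewrite (Auniq _ _ _ _ Aj Ai) => hj.
  have := mmd_tri y (s i) z; rewrite (mmdC y (s i)); move: hn hi hj.
  set q := n.+1%:R^-1; lra.
pose E := [set r | exists y, near r y].
pose x0 := mm_inhab X.
pose g r := if pselect (E r) is left h then projT1 (cid h) else x0.
have gnear r y : near r y -> g r = y.
  move=> ry; rewrite /g; case: pselect => [h|]; last by case; exists y.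
  exact: near_uniq (projT2 (cid h)) ry.
pose C n m i j : set TR := if `[< mm_dist (s i) (s j) <= n.+1%:R^-1 + m.+1%:R^-1 >]
  then A n i `&` A m j else set0.
have mC n m i j : measurable (C n m i j).
  by rewrite /C; case: asboolP => // _; exact: measurableI.
(* By completeness a code has a limit point exactly when the centres chosen at any two scales are no
   farther apart than the sum of the two radii. This is a countable condition. *)
have mE : measurable (E : set TR).
  have -> : E = \bigcap_n \bigcap_m \bigcup_i \bigcup_j C n m i j.
    apply/seteqP; split=> r.
      move=> [y ry] n _ m _; have [i Ai hi] := ry n; have [j Aj hj] := ry m.
      exists i => //; exists j => //; rewrite /C asboolT//.
      by apply: (le_trans (mmd_tri _ y _)); rewrite lerD// mmdC.
    move=> hr.
    have hA n : exists i, A n i r.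
      have [i _ [j _]] := hr n I n I; rewrite /C; case: asboolP => // _ [h _].
      by exists i.
    have [u hu] := choice hA.
    have ucau n m : mm_dist (s (u n)) (s (u m)) <= n.+1%:R^-1 + m.+1%:R^-1.
      have [i _ [j _]] := hr n I m I; rewrite /C; case: asboolP => // h [hi hj].
      by rewrite (Auniq _ _ _ _ (hu n) hi) (Auniq _ _ _ _ (hu m) hj).
    have [|y hy] := @mm_complete R X (s \o u).
      move=> e e0; have [N hN] := small (e / 2) (divr_gt0 e0 (ltr0Sn _ _)).
      exists N => m n Nm Nn; apply: (le_lt_trans (ucau _ _)).
      by rewrite (splitr e); apply: ltrD; apply: le_lt_trans hN; rewrite lef_pV2 ?posrE// ler_nat.
    exists y => n; exists (u n) => //; apply/ler_addgt0Pr => e e0.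
    have [N hN] := hy _ (divr_gt0 e0 (ltr0Sn R 1)).
    have [M hM] := small (e / 2) (divr_gt0 e0 (ltr0Sn _ _)).
    have h1 := hN (maxn N M) (leq_maxl _ _).
    have h2 : (maxn N M).+1%:R^-1 <= M.+1%:R^-1 :> R.
      by rewrite lef_pV2 ?posrE// ler_nat ltnS leq_maxr.
    have h3 := ucau n (maxn N M).
    have := mmd_tri (s (u n)) (s (u (maxn N M))) y.
    move: h1 h2 h3 hM; rewrite /=; set q1 := (maxn N M).+1%:R^-1; set q2 := M.+1%:R^-1; set q3 := n.+1%:R^-1; lra.
  by apply: bigcapT_measurable => n; apply: bigcapT_measurable => m;
    apply: bigcupT_measurable => i; apply: bigcupT_measurable => j.
exists g.
  apply: mm_measurable_fun => U oU.
  pose B n i : set TR := if `[< forall z, mm_dist (s i) z <= n.+1%:R^-1 -> U z >]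
    then A n i else set0.
  have mB n i : measurable (B n i) by rewrite /B; case: asboolP.
  have -> : g @^-1` U = (E `&` \bigcup_n \bigcup_i B n i) `|` (~` E `&` [set r | U x0]).
    apply/seteqP; split=> r.
      have [Er|nEr] := pselect (E r); last first.
        by rewrite /= /g; case: pselect => // _ Ux; right.
      have [y ry] := Er; rewrite /= (gnear _ _ ry) => Uy; left; split => //.
      have [e e0 he] := oU _ Uy.
      have [n hn] := small (e / 2) (divr_gt0 e0 (ltr0Sn _ _)).
      have [i Ai hi] := ry n; exists n => //; exists i => //.
      suff hU : forall z, mm_dist (s i) z <= n.+1%:R^-1 -> U z by rewrite /B asboolT.
      move=> z hz; apply: he; have := mmd_tri y (s i) z; rewrite (mmdC y (s i)); move: hn hi hz.
      by set q := n.+1%:R^-1; lra.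
    case=> [[Er [n _ [i _]]]|[nEr Ux]].
      have [y ry] := Er.
      rewrite /B; case: asboolP => // hU Ai; rewrite /= (gnear _ _ ry); apply: hU.
      exact: (near_dist _ _ _ _ ry Ai).
    by rewrite /= /g; case: pselect.
  apply: measurableU.
    apply: measurableI => //.
    by apply: bigcupT_measurable => n; apply: bigcupT_measurable => i.
  apply: measurableI; first exact: measurableC.
  exact: measurable_cst_set.
move=> r x hex hd; apply: gnear => n.
have [i Di hi] : exists2 i, D n i r & forall j, (j < i)%N -> ~ D n j r.
  have [i0 hi0] := hex n.
  have ex : exists i, `[< D n i r >] by exists i0; apply/asboolP.
  exists (ex_minn ex); case: ex_minnP => i /asboolP Di hmin // j ji Dj.
  by have := hmin j (introT (asboolP _) Dj); rewrite leqNgt ji.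
exists i; last exact/ltW/hd.
by split => // -[j ji Dj]; exact: hi ji Dj.
Qed.

(** Recording which balls of a countable base contain a point gives a Borel map [h] of [X] into the
    Cantor set, with a Borel left inverse [g]. The image of the measure under [h] is the law of some
    [q] on the interval, and [g \o q] is the parameter. *)
Lemma tparam_exists : exists phi : R -> mm_carrier X, tparam phi.
Proof.
have [s hs] := mm_separable X.
pose bit (k : nat) x := let p := odflt (0, 0)%N (unpickle k) in
  mm_dist (s p.2) x < p.1.+1%:R^-1.
pose h x : TR := ternlim R (bit^~ x).
have mh : measurable_fun setT h.
  apply: (measurable_fun_cvg (h := fun n x => tern R (bit^~ x) n)); last first.
    by move=> x _; exact: tern_is_cvg.
  move=> n; apply: measurable_sum => i; apply: measurable_funM => //.
  pose B := oball (s (odflt (0, 0)%N (unpickle i)).2) (odflt (0, 0)%N (unpickle i)).1.+1%:R^-1.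
  have -> : (fun x => (bit i x)%:R) = numfun.indic B :> (mm_carrier X -> R).
    apply/funext => x; rewrite numfun.indicE; congr ((nat_of_bool _)%:R).
    by rewrite /B /bit /oball; apply/idP/idP; rewrite inE.
  exact/measurable_indic/oball_measurable.
have [|g mg hg] := @decode_measurable s
    (fun n i => [set r | 1 / 2 < ternrem (pickle (n, i)) r]).
  move=> n i; have := @measurable_ternrem R (pickle (n, i)) measurableT `]1 / 2, +oo[%classic.
  rewrite setTI => /(_ (measurable_itv _)).
  by congr (measurable _); apply/seteqP; split=> r /=; rewrite in_itv/= andbT.
have gh x : g (h x) = x.
  apply: hg => [n|n i] /=.
    have [i hi] := hs x (n.+1%:R^-1) ltac:(by rewrite invr_gt0).
    by exists i; rewrite ternrem_lim /bit pickleK/= mmdC.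
  by rewrite ternrem_lim /bit pickleK.
have [|q [mq hq]] := @quantile_law R (image_law (mm_measure X) mh).
  apply: EFin_inj; rewrite -prE; last exact: measurable_itv.
  rewrite image_lawE -(probability_setT (mm_measure X)); congr (mm_measure X _).
  by apply/seteqP; split => // x _; rewrite /= in_itv/= ternlim01.
exists (g \o q); split; first exact: measurableT_comp.
move=> B mB; rewrite comp_preimage hq; last first.
  by rewrite -[X in measurable X]setTI; exact: mg.
rewrite image_lawE; congr (mm_measure X _).
by apply/seteqP; split=> x; rewrite /= gh.
Qed.

End param_exists.

(** * Coupling parameters *)

Section partition.
Context (R : realType) d (T : measurableType d) (P : probability T R).

Lemma pr_partition (idx : T -> nat) (n : nat) (B : set T) :
  (forall i, measurable [set x | idx x = i]) -> (forall x, (idx x < n)%N) ->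
  measurable B -> pr P B = \sum_(i < n) pr P (B `&` [set x | idx x = i]).
Proof.
move=> mi lt_n mB.
suff H k : pr P (B `&` [set x | (idx x < k)%N]) =
    \sum_(i < k) pr P (B `&` [set x | idx x = i]) /\ measurable [set x | (idx x < k)%N].
  have [<- _] := H n; congr (pr P _); apply/seteqP; split=> x Bx; last by case: Bx.
  by split => //; exact: lt_n.
elim: k => [|k [IH mk]].
  have -> : [set x | (idx x < 0)%N] = set0 by apply/seteqP; split.
  by rewrite setI0 pr0 big_ord0.
have -> : [set x | (idx x < k.+1)%N] = [set x | (idx x < k)%N] `|` [set x | idx x = k].
  apply/seteqP; split=> x /=; first by rewrite ltnS leq_eqVlt => /orP[/eqP|]; [right|left].
  by move=> [/ltnW//|->].
split; last exact: measurableU.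
rewrite setIUr prU_disj ?IH ?big_ord_recr//=.
- exact: measurableI.
- exact: measurableI.
- by apply/seteqP; split=> // x [[_ /= h] [_ /= h']]; move: h; rewrite h' ltnn.
Qed.

End partition.

(* [idx] assigns to a point the first ball of a finite net that contains it;
   the value [N] collects the few points missed by the net. *)
Lemma net_index (R : realType) (X : mmspace R) (r e : R) : 0 < r -> 0 < e ->
  exists (s : nat -> mm_carrier X) (N : nat) (idx : mm_carrier X -> nat),
    [/\ forall i, measurable [set x | idx x = i], forall x, (idx x <= N)%N,
        forall x, (idx x < N)%N -> mm_dist (s (idx x)) x < r &
        pr (mm_measure X) [set x | idx x = N] < e].
Proof.
move=> r0 e0; have [s [N hN]] := finite_net X r0 e0.
pose C x i := (mm_dist (s i) x < r) || (i == N).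
have exC x : exists i, C x i by exists N; rewrite /C eqxx orbT.
exists s, N, (fun x => ex_minn (exC x)).
have mC i : measurable [set x | C x i].
  have -> : [set x | C x i] = oball (s i) r `|` [set _ | i == N].
    apply/seteqP; split=> x /=; rewrite /C.
      by move=> /orP[|]; [left|right].
    by move=> [h|h]; apply/orP; [left|right].
  apply: measurableU; first exact: oball_measurable.
  exact: measurable_cst_set.
have mE x i : ex_minn (exC x) = i <-> (C x i /\ forall j, (j < i)%N -> ~ C x j).
  case: ex_minnP => m Cm minm; split=> [<-|[Ci ni]].
    by split => // j jm /minm; rewrite leqNgt jm.
  by apply/eqP; rewrite eqn_leq minm//= leqNgt; apply/negP => /ni; exact.
have mI i : measurable [set x | ex_minn (exC x) = i].
  have -> : [set x | ex_minn (exC x) = i] =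
      [set x | C x i] `\` \bigcup_(j in [set j | (j < i)%N]) [set x | C x j].
    apply/seteqP; split=> x /=.
      by move=> /mE[Ci ni]; split=> // -[j /= ji /(ni _ ji)].
    by move=> [Ci ni]; apply/mE; split=> // j ji Cj; apply: ni; exists j.
  by apply: measurableD => //; apply: bigcup_measurable.
split=> //.
- by move=> x; case: ex_minnP => m _; apply; rewrite /C eqxx orbT.
- move=> x; case: ex_minnP => m + _ mN; rewrite /C => /orP[//|/eqP mN'].
  by move: mN; rewrite mN' ltnn.
- have mF : measurable [set x | exists2 i, (i < N)%N & mm_dist (s i) x < r].
    have -> : [set x | exists2 i, (i < N)%N & mm_dist (s i) x < r] =
      \bigcup_(i in [set i | (i < N)%N]) oball (s i) r by apply/seteqP; split.
    by apply: bigcup_measurable => i _; exact: oball_measurable.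
  have : pr (mm_measure X) [set x | ex_minn (exC x) = N] <=
     pr (mm_measure X) (~` [set x | exists2 i, (i < N)%N & mm_dist (s i) x < r]).
    apply: le_pr => //; first exact: measurableC.
    move=> x /mE[_ h] [i iN hi]; by apply: (h i iN); rewrite /C hi.
  by rewrite prC//; lra.
Qed.

Section real_mmspace.
Variable R : realType.
Notation TR := (measurableTypeR R).

Lemma dR_metric : is_metric (fun x y : TR => `|x - y| : R).
Proof.
split=> [x y|x y|x y|x y z].
- exact: normr_ge0.
- by split=> [/normr0P|->]; rewrite ?subrr ?normr0// subr_eq0 => /eqP.
- exact: distrC.
- exact: ler_distD.
Qed.

Lemma dR_complete : d_complete (fun x y : TR => `|x - y| : R).
Proof.
move=> u cu; have : cvgn (u : nat -> R).
  apply/cauchy_cvgP/cauchy_exP => e e0; have [N hN] := cu e e0.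
  by exists (u N); exists N => // n Nn; exact: hN.
move=> /cvg_ex[l ul]; exists l => e e0.
have /cvgrPdist_lt/(_ e e0)[N _ hN] := ul.
by exists N => n Nn; rewrite distrC; exact: hN.
Qed.

Lemma dR_separable : d_separable (fun x y : TR => `|x - y| : R).
Proof.
exists (fun n => ratr (odflt 0%Q (unpickle n))) => x e e0.
have [q] := @rat_in_itvoo R (x - e) (x + e) ltac:(lra).
rewrite in_itv/= => /andP[h1 h2]; exists (pickle q); rewrite pickleK/=.
by rewrite ltr_norml; apply/andP; split; lra.
Qed.

Lemma dR_borel : @measurable _ TR = <<s d_open (fun x y : TR => `|x - y| : R) >>.
Proof.
apply/seteqP; split.
  rewrite [X in X `<=` _](_ : _ = <<s @RGenOpens.G R >>); last exact: RGenOpens.measurableE.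
  apply: smallest_sub; first exact: smallest_sigma_algebra.
  move=> _ [a [b ->]]; apply: sub_sigma_algebra => x /=.
  rewrite in_itv/= => /andP[ax xb].
  exists (Num.min (x - a) (b - x)); first by rewrite lt_min !subr_gt0 ax.
  move=> y; rewrite lt_min in_itv/= => /andP[]; rewrite !ltr_norml => /andP[h1 h2] /andP[h3 h4].
  by apply/andP; split; lra.
apply: smallest_sub; first exact: sigma_algebra_measurable.
move=> U oU; apply: open_measurable; rewrite openE => x Ux.
have [e e0 he] := oU x Ux; apply/nbhs_ballP; exists e => //= y; exact: he.
Qed.

(** Turns a coupling of two uniform variables into a measure on a product of mm-spaces, so that the
    coupling has a parameter too. *)
Definition mmreal : mmspace R :=
  MMSpace dR_metric dR_complete dR_separable dR_borel (unif R).

End real_mmspace.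

Section coupling.
Variable R : realType.
Notation TR := (measurableTypeR R).
Notation U := (unif R).
Local Open Scope ereal_scope.

(* Conditionally on the common value of the indices [a] and [b], the two
   coordinates are independent. *)
Variables (a b : TR -> nat) (n : nat).
Hypotheses (ma : forall i, measurable [set s | a s = i])
  (mb : forall i, measurable [set s | b s = i])
  (an : forall s, (a s < n)%N) (bn : forall s, (b s < n)%N)
  (ab : forall i, pr U [set s | a s = i] = pr U [set s | b s = i]).

Definition cell i : set (TR * TR) := [set s | a s = i] `*` [set s | b s = i].

Lemma measurable_cell i : measurable (cell i).
Proof. exact: measurableX. Qed.

(** The product measure on the [i]-th cell, divided by the mass of the index so that the marginals
    come out right. For an index of mass zero the convention for the inverse of [0] yields the zero
    measure. *)
Definition couple_meas (i : nat) : {measure set (TR * TR) -> \bar R} :=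
  mscale (NngNum (introT idP (ltac:(rewrite invr_ge0; exact: pr_ge0) :
    (0 <= (pr U [set s | a s = i])^-1)%R))) (mrestr (U \x U) (measurable_cell i)).

Definition couple0 : set (TR * TR) -> \bar R := msum couple_meas n.

HB.instance Definition _ := Measure.on couple0.

Lemma couple0X (B C : set TR) : measurable B -> measurable C ->
  couple0 (B `*` C) = (\sum_(i < n) (pr U [set s | a s = i])^-1 *
    (pr U (B `&` [set s | a s = i]) * pr U (C `&` [set s | b s = i])))%R%:E.
Proof.
move=> mB mC; rewrite /couple0 /msum -sumEFin; apply: eq_bigr => i _.
rewrite /couple_meas /= /mscale /= /mrestr /cell -setXI.
rewrite product_measure1E; [|exact: measurableI..].
by rewrite !EFinM; congr (_ * (_ * _)); apply: prE; exact: measurableI.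
Qed.

Let cancel (B : set TR) i : measurable B ->
  ((pr U [set s | a s = i])^-1 * (pr U (B `&` [set s | a s = i]) * pr U [set s | a s = i])
   = pr U (B `&` [set s | a s = i]))%R.
Proof.
move=> mB; have [h|h] := eqVneq (pr U [set s | a s = i]) 0%R; last first.
  by rewrite mulrCA mulVf// mulr1.
rewrite h mulr0 mulr0; apply/eqP; rewrite eq_le pr_ge0 /=.
by rewrite -h; apply: le_pr => //; exact: measurableI.
Qed.

Lemma couple0l (B : set TR) : measurable B -> couple0 (B `*` setT) = (pr U B)%:E.
Proof.
move=> mB; rewrite couple0X//; congr EFin; rewrite (pr_partition U ma an mB).
by apply: eq_bigr => i _; rewrite setTI -ab cancel.
Qed.

Lemma couple0r (B : set TR) : measurable B -> couple0 (setT `*` B) = (pr U B)%:E.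
Proof.
move=> mB; rewrite couple0X//; congr EFin; rewrite (pr_partition U mb bn mB).
apply: eq_bigr => i _; rewrite setTI ab (mulrC (pr U _) (pr U (_ `&` _))).
have [h|h] := eqVneq (pr U [set s | b s = i]) 0%R; last first.
  by rewrite mulrCA mulVf// mulr1.
rewrite h mulr0 mulr0; apply/eqP; rewrite eq_sym eq_le pr_ge0 andbT.
by rewrite -h; apply: le_pr => //; exact: measurableI.
Qed.

Lemma couple0T : couple0 setT = 1.
Proof. by rewrite -setXTT couple0l// prT. Qed.

HB.instance Definition _ := Measure_isProbability.Build _ _ _ couple0 couple0T.

Definition couple : probability (TR * TR)%type R := couple0.

Lemma couple_diag : couple [set p | a p.1 = b p.2] = 1.
Proof.
have mi i j : measurable ([set s | a s = i] `*` [set s | b s = j]) by exact: measurableX.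
have mD : measurable [set p : TR * TR | a p.1 = b p.2].
  have -> : [set p : TR * TR | a p.1 = b p.2] = \bigcup_i cell i.
    apply/seteqP; split=> [p /= h|p [i _ [/= -> ->]]//].
    by exists (a p.1) => //; split => //=.
  by apply: bigcupT_measurable => i; exact: measurable_cell.
suff : couple (~` [set p | a p.1 = b p.2]) = 0.
  rewrite probability_setC// prE//= => -[/eqP]; rewrite subr_eq0 => /eqP <- //.
apply: measure_negligible; first exact: measurableC.
have -> : ~` [set p : TR * TR | a p.1 = b p.2] =
  \bigcup_i (\bigcup_j (if i == j then set0 else [set s | a s = i] `*` [set s | b s = j])).
  apply/seteqP; split=> [p /= h|p [i _ [j _]]].
    exists (a p.1) => //; exists (b p.2) => //; rewrite ifF//.
    exact/eqP.
  by case: eqP => // ij [/= -> ->].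
apply: negligible_bigcup => i; apply: negligible_bigcup => j.
case: eqP => [_|ij]; first exact: negligible_set0.
exists ([set s | a s = i] `*` [set s | b s = j]); split => //.
rewrite /couple/= couple0X//; congr EFin; apply: big1 => k _.
have [ik|ik] := eqVneq i k.
  rewrite [X in (_ * (_ * pr _ X))%R](_ : _ = set0) ?pr0 ?mulr0//.
  by apply/seteqP; split=> // s [/= -> jk]; apply: ij; rewrite ik jk.
rewrite [X in (_ * (pr _ X * _))%R](_ : _ = set0) ?pr0 ?mul0r ?mulr0//.
by apply/seteqP; split=> // s [/= -> /eqP]; rewrite (negbTE ik).
Qed.

End coupling.

(** * The asymmetric box relation *)

Lemma inf_nneg (R : realType) (A : set R) : (forall x, A x -> 0 <= x) -> 0 <= inf A.
Proof.
move=> h; have [->|/set0P A0] := eqVneq A set0; first by rewrite inf0.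
exact: lb_le_inf.
Qed.

Section glue.
Variable R : realType.
Notation TR := (measurableTypeR R).

Lemma law_comp d (T : measurableType d) (P : probability T R) (phi : R -> T)
  (theta : R -> TR) : law P phi -> law (unif R) theta -> law P (phi \o theta).
Proof.
move=> [mphi hphi] [mt ht]; split; first exact: (measurableT_comp mphi mt).
move=> B mB; rewrite comp_preimage ht ?hphi//.
by rewrite -[X in measurable X]setTI; exact: mphi.
Qed.

(** The two parameters are coupled so that they fall in the same cell of a net of radius [r / 2].
    They are then [r]-close, except on the mass missed by the net. *)
Lemma glue (Y : mmspace R) (psi psi' : R -> mm_carrier Y) (r e : R) :
  tparam psi -> tparam psi' -> 0 < r -> 0 < e ->
  exists theta theta' : R -> TR, exists2 N : set TR,
    [/\ law (unif R) theta, law (unif R) theta' & measurable N] &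
    1 - e <= pr (unif R) N /\
    forall s, N s -> mm_dist (psi (theta s)) (psi' (theta' s)) <= r.
Proof.
move=> hpsi hpsi' r0 e0.
have [x [N [idx [mi leN ltN mN]]]] := net_index Y (divr_gt0 r0 (ltr0Sn R 1)) e0.
have ma i : measurable [set s : TR | idx (psi s) = i] by exact: (law_meas hpsi (mi i)).
have mb i : measurable [set s : TR | idx (psi' s) = i] by exact: (law_meas hpsi' (mi i)).
have an s : (idx (psi s) < N.+1)%N by rewrite ltnS.
have bn s : (idx (psi' s) < N.+1)%N by rewrite ltnS.
have ab i : pr (unif R) [set s | idx (psi s) = i] = pr (unif R) [set s | idx (psi' s) = i].
  by rewrite [LHS](law_pr hpsi (mi i)) [RHS](law_pr hpsi' (mi i)).
pose C := couple ma mb an ab.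
(* The coupling, seen as an mm-space, has a parameter; its two coordinates are the required changes
   of variable. *)
have [th hth] := tparam_exists (@mmprod R (mmreal R) (mmreal R) C).
have hC B : measurable B -> unif R (th @^-1` B) = C B by case: hth => _; apply.
have mth : measurable_fun setT th by case: hth.
have mD : measurable [set p : TR * TR | idx (psi p.1) = idx (psi' p.2)].
  have -> : [set p : TR * TR | idx (psi p.1) = idx (psi' p.2)] =
      \bigcup_i (cell (idx \o psi) (idx \o psi') i).
    apply/seteqP; split=> [p /= h|p [i _ [/= -> ->]]//].
    by exists (idx (psi p.1)) => //; split => //=.
  by apply: bigcupT_measurable => i; exact: measurable_cell.
have mA : measurable [set p : TR * TR | idx (psi p.1) = N].
  have -> : [set p : TR * TR | idx (psi p.1) = N] = [set s | idx (psi s) = N] `*` setT.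
    by apply/seteqP; split=> // p [].
  exact: measurableX.
exists (fst \o th), (snd \o th).
exists (th @^-1` ([set p | idx (psi p.1) = idx (psi' p.2)] `&` ~` [set p | idx (psi p.1) = N])).
  split.
  - split; first exact: (measurableT_comp measurable_fst mth).
    move=> B mB; rewrite comp_preimage hC; last first.
      by rewrite -[X in measurable X]setTI; exact: measurable_fst.
    rewrite [RHS]prE// -(couple0l ma mb an ab mB); congr (C _).
    by apply/seteqP; split=> // p [].
  - split; first exact: (measurableT_comp measurable_snd mth).
    move=> B mB; rewrite comp_preimage hC; last first.
      by rewrite -[X in measurable X]setTI; exact: measurable_snd.
    rewrite [RHS]prE// -(couple0r ma mb bn ab mB); congr (C _).
    by apply/seteqP; split=> // p [].
  - rewrite -[X in measurable X]setTI; apply: mth => //.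
    by apply: measurableI => //; exact: measurableC.
split.
  have -> : pr (unif R) (th @^-1` ([set p | idx (psi p.1) = idx (psi' p.2)] `&`
      ~` [set p | idx (psi p.1) = N])) = pr C ([set p | idx (psi p.1) = idx (psi' p.2)] `&`
      ~` [set p | idx (psi p.1) = N]).
    by rewrite /pr hC//; apply: measurableI => //; exact: measurableC.
  rewrite -[e]add0r; apply: prI_ge => //; first exact: measurableC.
    by rewrite /pr /C couple_diag subr0.
  rewrite prC// lerD2l lerN2.
  have -> : pr C [set p | idx (psi p.1) = N] = pr (mm_measure Y) [set y | idx y = N].
    rewrite -(law_pr hpsi (mi N)) {1}/pr.
    have -> : [set p : TR * TR | idx (psi p.1) = N] = [set s | idx (psi s) = N] `*` setT.
      by apply/seteqP; split=> // p [].
    by have := couple0l ma mb an ab (ma N) => /= ->.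
  exact: ltW.
move=> s [/= hd hN]; set y := psi _; set y' := psi' _.
have yN : (idx y < N)%N by rewrite ltn_neqAle leN andbT; exact/eqP.
have y'N : (idx y' < N)%N by rewrite /y' -hd.
have h1 := ltN _ yN; have h2 := ltN _ y'N; move: h2; rewrite /y' -hd -/y -/y' => h2.
have := mmd_tri y (x (idx y)) y'; rewrite (mmdC y (x (idx y))); lra.
Qed.

Definition Dle (e : R) (W Z : mmspace R) : Prop :=
  exists (phi : R -> mm_carrier W) (psi : R -> mm_carrier Z) (I0 : set TR),
    [/\ tparam phi, tparam psi, measurable I0, 1 - e <= pr (unif R) I0 &
      forall s t, I0 s -> I0 t ->
        mm_dist (phi s) (phi t) <= mm_dist (psi s) (psi t) + e].

Definition boxle (e : R) (W Z : mmspace R) : Prop :=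
  exists (phi : R -> mm_carrier W) (psi : R -> mm_carrier Z) (I0 : set TR),
    [/\ tparam phi, tparam psi, measurable I0, 1 - e <= pr (unif R) I0 &
      forall s t, I0 s -> I0 t ->
        `|mm_dist (phi s) (phi t) - mm_dist (psi s) (psi t)| <= e].

Lemma boxle_sym e W Z : boxle e W Z -> boxle e Z W.
Proof.
move=> [phi [psi [I0 [h1 h2 h3 h4 h5]]]]; exists psi, phi, I0; split => // s t Is It.
by rewrite distrC h5.
Qed.

Lemma boxle_Dle e W Z : boxle e W Z -> Dle e W Z.
Proof.
move=> [phi [psi [I0 [h1 h2 h3 h4 h5]]]]; exists phi, psi, I0; split => // s t Is It.
by have := h5 s t Is It; rewrite ler_norml => /andP[]; lra.
Qed.

Lemma Dle_le e e' W Z : e <= e' -> Dle e W Z -> Dle e' W Z.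
Proof.
move=> ee' [phi [psi [I0 [h1 h2 h3 h4 h5]]]]; exists phi, psi, I0; split => //.
  lra.
by move=> s t Is It; have := h5 s t Is It; lra.
Qed.

Lemma boxle_le e e' W Z : e <= e' -> boxle e W Z -> boxle e' W Z.
Proof.
move=> ee' [phi [psi [I0 [h1 h2 h3 h4 h5]]]]; exists phi, psi, I0; split => //.
  lra.
by move=> s t Is It; have := h5 s t Is It; lra.
Qed.

Lemma Dle_tri e e' eta W Y Z : 0 < eta -> Dle e W Y -> Dle e' Y Z ->
  Dle (e + e' + eta) W Z.
Proof.
move=> eta0 [phi [psi [I1 [hphi hpsi mI1 lI1 H1]]]] [psi' [chi [I2 [hpsi' hchi mI2 lI2 H2]]]].
(* In the middle space both [s] and [t] contribute a gluing error, hence the half; the measure of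
   the bad set loses [eta] once. *)
have r0 : 0 < eta / 2 by rewrite divr_gt0.
have [th [th' [N [hth hth' mN] [lN HN]]]] := glue hpsi hpsi' r0 eta0.
exists (phi \o th), (chi \o th'), ((th @^-1` I1 `&` th' @^-1` I2) `&` N); split.
- exact: law_comp.
- exact: law_comp.
- by do 2 apply: measurableI => //; [exact: law_meas hth _|exact: law_meas hth' _].
- apply: prI_ge => //.
    by apply: measurableI; [exact: law_meas hth _|exact: law_meas hth' _].
  apply: prI_ge; [exact: law_meas hth _|exact: law_meas hth' _| |].
    by rewrite (law_pr hth).
  by rewrite (law_pr hth').
- move=> s t [[/= s1 s2] sN] [[/= t1 t2] tN].
  have := H1 _ _ s1 t1; have := H2 _ _ s2 t2; have := HN _ sN; have := HN _ tN.
  have := mmd_lip2 (psi (th s)) (psi (th t)) (psi' (th' s)) (psi' (th' t)).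
  rewrite ler_norml => /andP[_]; lra.
Qed.

Lemma lip_dom_Dle W Z : lip_dom W Z -> Dle 0 W Z.
Proof.
move=> [f [lf hf]]; have [psi hpsi] := tparam_exists Z.
have mf := nonexpansive_measurable lf.
have mpsi : measurable_fun setT psi by case: hpsi.
exists (f \o psi), psi, setT; split => //.
- split; first exact: (measurableT_comp mf mpsi).
  move=> B mB; rewrite comp_preimage; case: hpsi => _ -> //; first exact: hf.
  by rewrite -[X in measurable X]setTI; exact: mf.
- by rewrite prT subr0.
- by move=> s t _ _; rewrite addr0; exact: lf.
Qed.

Lemma le_box e W Z : 0 <= e -> boxle e W Z -> box W Z <= e.
Proof.
move=> e0 [phi [psi [I0 [hphi hpsi mI lI H]]]]; apply: ge_inf.
  by exists 0 => x [].
split=> //; exists phi, psi, (I01 (R := R) `&` I0); split.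
- by split; exact: tparam_param.
- by apply: measurableI => //; exact: measurable_I01.
- by move=> s [].
- by rewrite -unif_leb prE// lee_fin.
- by move=> s t [_ Is] [_ It]; exact: H.
Qed.

Lemma box_ge0 W Z : 0 <= box W Z :> R.
Proof. by apply: inf_nneg => x []. Qed.

Lemma box_lt e W Z : box W Z < e -> exists2 e', 0 <= e' < e & boxle e' W Z.
Proof.
move=> /inf_lt[].
  exists 1; split=> //; have [phi hphi] := tparam_exists W; have [psi hpsi] := tparam_exists Z.
  exists phi, psi, set0; split => //; first by split; exact: tparam_param.
  by rewrite subrr /leb measure0.
move=> e' [e'0 [phi [psi [I0 [[hphi hpsi] mI II lI H]]]]] e'e; exists e'.
  by rewrite e'0.
exists (phi \o @clamp R), (psi \o @clamp R), I0; split => //.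
- exact: param_tparam.
- exact: param_tparam.
- by rewrite -lee_fin -prE// unif_leb setIidr.
- by move=> s t Is It; rewrite /= !clampE; [exact: H|exact: II..].
Qed.

(* A space almost dominated by [Z] is close to one dominated by [Z]: extend the
   distance functions of [W] to 1-Lipschitz functions on [Z] and measure [Z]
   with their supremum; the term [tau * min(d, 1)] keeps this a metric. *)
Lemma Dle_shrink e tau W Z : 0 <= e -> 0 < tau <= 1 -> Dle e W Z ->
  exists2 W', lip_dom W' Z & boxle (e + tau) W W'.
Proof.
move=> e0 /andP[tau0 tau1] [phi [psi [I0 [hphi hpsi mI lI H]]]].
have ext w : exists f : mm_carrier Z -> R, lip1 f /\
    forall s, I0 s -> mm_dist w (phi s) - e <= f (psi s) <= mm_dist w (phi s).
  have [f lf hf] := @mcshane R Z R I0 psi (fun s => mm_dist w (phi s)) e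
    ltac:(move=> s t Is It; apply: le_trans (H s t Is It);
      apply: le_trans (ler_norm _) _; exact: mmd_lip).
  by exists f.
have [f hf] := choice ext.
pose A x y := [set `|f w x - f w y| | w in setT].
have ubA x y : ubound (A x y) (mm_dist x y) by move=> _ [w _ <-]; case: (hf w) => + _; apply.
have supA x y : has_sup (A x y).
  split; last by exists (mm_dist x y); exact: ubA.
  by exists `|f (mm_inhab W) x - f (mm_inhab W) y|, (mm_inhab W).
have leA w x y : `|f w x - f w y| <= sup (A x y).
  by apply: ub_le_sup; [case: (supA x y)|exists w].
pose d1 (x y : mm_carrier Z) : R := tau * Num.min (mm_dist x y) 1.
pose d' x y := Num.max (sup (A x y)) (d1 x y).
have d10 x y : 0 <= d1 x y by rewrite mulr_ge0 ?(ltW tau0)// le_min mmd_ge0 ler01.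
have d1u x y : d1 x y <= mm_dist x y.
  apply: (@le_trans _ _ (1 * mm_dist x y)); last by rewrite mul1r.
  by rewrite /d1 ler_pM ?(ltW tau0)// ?ge_min ?lexx// le_min mmd_ge0 ler01.
have Au x y : sup (A x y) <= mm_dist x y by apply: ge_sup; [case: (supA x y)|exact: ubA].
have d'u x y : d' x y <= mm_dist x y by rewrite ge_max Au d1u.
have d'm : is_metric d'.
  split.
  - by move=> x y; rewrite le_max d10 orbT.
  - move=> x y; split=> [h|->].
      have : d1 x y <= 0 by rewrite -h le_max lexx orbT.
      rewrite /d1 pmulr_rle0// ge_min => /orP[h'|]; last by rewrite leNgt ltr01.
      by apply: mmd_eq0; apply/eqP; rewrite eq_le h' mmd_ge0.
    apply/eqP; rewrite eq_le le_max d10 orbT andbT -[X in _ <= X](mmdxx y).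
    exact: d'u.
  - move=> x y; rewrite /d' /d1 mmdC; congr (Num.max (sup _) _).
    by apply/seteqP; split=> _ [w _ <-]; exists w => //; rewrite distrC.
  - move=> x y z; rewrite ge_max; apply/andP; split.
      apply: (@le_trans _ _ (sup (A x y) + sup (A y z))); last first.
        by rewrite lerD// le_max lexx.
      apply: ge_sup; first by case: (supA x z).
      move=> _ [w _ <-]; apply: (le_trans (ler_distD (f w y) _ _)).
      by rewrite lerD// leA.
    apply: (@le_trans _ _ (d1 x y + d1 y z)); last by rewrite lerD// le_max lexx orbT.
    rewrite /d1 -mulrDr ler_pM2l//.
    have h1 := mmd_tri x y z; have h2 := mmd_ge0 x y; have h3 := mmd_ge0 y z.
    case: (leP (mm_dist x y) 1) => h4; case: (leP (mm_dist y z) 1) => h5;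
      rewrite ge_min; apply/orP; [left|right|right|right]; lra.
have d'l x y : tau * Num.min (mm_dist x y) 1 <= d' x y by rewrite le_max lexx orbT.
exists (remetric d'm tau0 d'l d'u).
  by exists id; split=> //= x y; exact: d'u.
exists phi, psi, I0; split => //; first lra.
move=> s t Is It /=.
(* The choice [w = phi s] bounds the supremum from below. From above, for every [w] the two values
   of [f w] lie at most [e] under the distances from [w], which differ by at most the distance of
   [phi s] and [phi t]. *)
have key : `|mm_dist (phi s) (phi t) - sup (A (psi s) (psi t))| <= e.
  rewrite ler_norml; apply/andP; split; last first.
    have := leA (phi s) (psi s) (psi t); case: (hf (phi s)) => _ h.
    have := h s Is; have := h t It; rewrite mmdxx => /andP[h1 h2] /andP[h3 h4].
    rewrite ler_norml => /andP[h5 h6]; lra.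
  rewrite lerBrDr addrC -lerBrDr opprK; apply: ge_sup; first by case: (supA (psi s) (psi t)).
  move=> _ [w _ <-]; case: (hf w) => _ h; have := h s Is; have := h t It.
  have := mmd_lip w (phi s) (phi t); rewrite !ler_norml => /andP[h1 h2] /andP[h3 h4] /andP[h5 h6].
  apply/andP; split; lra.
have hd1 : 0 <= d1 (psi s) (psi t) <= tau.
  by rewrite d10/= /d1 ger_pMr// ge_min lexx orbT.
move: key hd1; rewrite /d' !ler_norml => /andP[h1 h2] /andP[h3 h4].
have := mmd_ge0 (phi s) (phi t).
rewrite /Num.max; case: ltP => h5 h6; apply/andP; split; lra.
Qed.

End glue.

(** * Compactness *)

Lemma inv_succ_lt (R : realType) (e : R) : 0 < e ->
  exists n : nat, forall m, (n <= m)%N -> m.+1%:R^-1 < e.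
Proof.
move=> /ltr_add_invr[n]; rewrite add0r => hn; exists n => m nm.
by apply: le_lt_trans hn; rewrite lef_pV2 ?posrE// ler_nat.
Qed.

Section support.
Context (R : realType) (X : mmspace R).

(** Discard the null balls of a countable base. There are countably many, so a set of full measure
    remains, and each ball around one of its points contains a base ball of positive mass. *)
Lemma full_support : exists S : set (mm_carrier X),
  [/\ measurable S, pr (mm_measure X) S = 1 &
    forall x r, S x -> 0 < r -> 0 < pr (mm_measure X) (oball x r)].
Proof.
have [s hs] := mm_separable X.
pose B (n : nat) := let p := odflt (0, 0)%N (unpickle n) in oball (s p.1) p.2.+1%:R^-1.
have mB n : measurable (B n) by exact: oball_measurable.
pose C n := if pr (mm_measure X) (B n) == 0 then ~` B n else setT.
have mC n : measurable (C n).
  by rewrite /C; case: ifP => _ //; exact: measurableC.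
exists (\bigcap_n C n); split; first exact: bigcapT_measurable.
  apply: pr_bigcap1 => // n; rewrite /C; case: ifPn => [/eqP h|_]; last exact: prT.
  by rewrite prC// h subr0.
move=> x r Sx r0; have [j hj] := inv_succ_lt (divr_gt0 r0 (ltr0Sn R 1)).
have [i hi] := hs x (j.+1%:R^-1) ltac:(by rewrite invr_gt0).
have := Sx (pickle (i, j)) I; rewrite /C.
have BE : B (pickle (i, j)) = oball (s i) j.+1%:R^-1 by rewrite /B pickleK.
case: ifPn => [_|h _]; first by rewrite BE /oball/= mmdC hi.
apply: (@lt_le_trans _ _ (pr (mm_measure X) (B (pickle (i, j))))).
  by rewrite lt_neqAle pr_ge0 eq_sym h.
apply: le_pr => //; first exact: oball_measurable.
rewrite BE => y; rewrite /oball/= => hy.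
have := mmd_tri x (s i) y; have := hj j (leqnn _).
by move: hi hy; set q := j.+1%:R^-1; lra.
Qed.

(** Laws with arbitrarily good Ky Fan couplings coincide. An open [U] is exhausted by the sets [V n]
    of points whose [1/(n+1)]-ball lies in [U]; a coupling finer than that radius carries [V n] into
    [U] up to a small mass. Open sets form a pi-system. *)
Lemma prob_eq (P1 P2 : probability (mm_carrier X) R) :
  (forall e, 0 < e -> exists (a b : R -> mm_carrier X) (I : set (measurableTypeR R)),
    [/\ law P1 a, law P2 b, measurable I, 1 - e <= pr (unif R) I &
      forall s, I s -> mm_dist (a s) (b s) <= e]) ->
  forall B, measurable B -> P1 B = P2 B.
Proof.
move=> H.
have half (Q1 Q2 : probability (mm_carrier X) R) :
    (forall e, 0 < e -> exists (a b : R -> mm_carrier X) (I : set (measurableTypeR R)),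
    [/\ law Q1 a, law Q2 b, measurable I, 1 - e <= pr (unif R) I &
      forall s, I s -> mm_dist (a s) (b s) <= e]) ->
    forall U, d_open (@mm_dist R X) U -> pr Q1 U <= pr Q2 U.
  move=> HQ U oU; have mU := d_open_measurable oU.
  pose V n : set (mm_carrier X) := [set y | forall z, mm_dist y z < n.+1%:R^-1 -> U z].
  have mV n : measurable (V n).
    rewrite -[V n]setCK; apply: measurableC; apply: d_open_measurable => y /= hy.
    have [z [yz nUz]] : exists z, mm_dist y z < n.+1%:R^-1 /\ ~ U z.
      by move: hy => /existsNP[z /not_implyP]; exists z.
    exists (n.+1%:R^-1 - mm_dist y z); first by rewrite subr_gt0.
    move=> y' yy' hV; apply: nUz; apply: hV.
    have := mmd_tri y' y z; rewrite (mmdC y' y); move: yy'; set q := n.+1%:R^-1; lra.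
  have UV : U = \bigcup_n V n.
    apply/seteqP; split=> [y Uy|y [n _ hn]]; last first.
      by apply: hn; rewrite mmdxx invr_gt0.
    have [e e0 he] := oU y Uy; have [n hn] := inv_succ_lt e0.
    by exists n => // z yz; apply: he; exact: lt_trans yz (hn n (leqnn n)).
  have VQ n : pr Q1 (V n) <= pr Q2 U.
    apply/ler_addgt0Pr => e e0.
    pose e' : R := Num.min e (n.+1%:R^-1 / 2).
    have e'0 : 0 < e' by rewrite lt_min e0 divr_gt0// invr_gt0.
    have [a [b [I [la lb mI lI hI]]]] := HQ _ e'0.
    rewrite -(law_pr la (mV n)) -(law_pr lb mU).
    apply: (@le_trans _ _ (pr (unif R) (b @^-1` U `|` ~` I))).
      apply: le_pr; [exact: law_meas la _| |].
        by apply: measurableU; [exact: law_meas lb _|exact: measurableC].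
      move=> s /= Vs; have [Is|] := pselect (I s); last by right.
      left; apply: Vs; apply: le_lt_trans (hI s Is) _.
      rewrite gt_min; apply/orP; right.
      have : 0 < n.+1%:R^-1 :> R by rewrite invr_gt0.
      by set q := n.+1%:R^-1; lra.
    apply: (le_trans (prU _ (law_meas lb mU) (measurableC mI))).
    rewrite prC// lerD2l; have : e' <= e by rewrite ge_min lexx.
    lra.
  apply/ler_addgt0Pr => e e0.
  have ndV : {homo V : n m / (n <= m)%N >-> n `<=` m}.
    move=> n m nm y h z yz; apply: h; apply: lt_le_trans yz _.
    by rewrite lef_pV2 ?posrE// ler_nat.
  have [n] := pr_bigcup_approx Q1 mV ndV e0.
  by rewrite -UV; have := VQ n; lra.
move=> B mB.
apply: (@measure_unique _ R (mm_carrier X) (d_open (@mm_dist R X)) (fun=> setT)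
  _ _ _ _ P1 P2) => //.
- exact: mm_borel.
- move=> U V oU oV x [Ux Vx]; have [e e0 he] := oU x Ux; have [e' e'0 he'] := oV x Vx.
  exists (Num.min e e'); first by rewrite lt_min e0.
  by move=> y; rewrite lt_min => /andP[/he ? /he' ?].
- by move=> _ x _; exists 1.
- by apply/seteqP; split => // x _; exists 0%N.
- move=> U oU; have mU := d_open_measurable oU.
  change (P1 U = P2 U); rewrite !prE//; congr EFin; apply/eqP; rewrite eq_le.
  apply/andP; split; first exact: half.
  apply: half => // e e0; have [a [b [I [la lb mI lI hI]]]] := H e e0.
  by exists b, a, I; split => // s Is; rewrite mmdC hI.
- move=> _; change (P1 setT < +oo)%E; by rewrite probability_setT ltry.
Qed.

End support.

Section ultra.
Variable G : set_system nat.
Hypothesis GU : UltraFilter G.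

Lemma ultra_pigeonhole (E : nat -> nat -> Prop) (N : nat) :
  G [set k | exists2 i, (i < N)%N & E i k] -> exists2 i, (i < N)%N & G (E i).
Proof.
elim: N => [|N IH] h.
  have : G set0 by apply: filterS h => k [].
  by move=> /filter_not_empty.
have [h1|h1] := in_ultra_setVsetC (E N) GU; first by exists N.
have [|i iN Gi] := IH; last by exists i => //; exact: ltnW.
apply: filterS2 h h1 => k [i]; rewrite ltnS leq_eqVlt => /orP[/eqP ->//|iN] Ei _.
by exists i.
Qed.

Lemma ultra_finite_inter (E : nat -> nat -> Prop) (N : nat) :
  (forall i, (i < N)%N -> G (E i)) -> G [set k | forall i, (i < N)%N -> E i k].
Proof.
elim: N => [|N IH] h; first by apply: filterS filterT => k _ i.
have h1 := IH (fun i iN => h i (ltnW iN)).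
apply: filterS2 h1 (h N (ltnSn N)) => k hk EN i.
by rewrite ltnS leq_eqVlt => /orP[/eqP ->//|/hk].
Qed.

End ultra.

Section compactness.
Variables (R : realType) (Y Z : mmspace R).
Hypothesis YZ : forall e, 0 < e -> Dle e Y Z.

(** The map is an ultralimit of the approximate dominations. It is built on a full-measure set [S]
    of support points, where enough mass is available, and set to a constant elsewhere; hence the
    Lipschitz bound holds on [S] only. *)
Lemma Dle0_lip : exists (f : mm_carrier Z -> mm_carrier Y) (S : set (mm_carrier Z)),
  [/\ measurable_fun setT f, measurable S, pr (mm_measure Z) S = 1,
    forall x x', S x -> S x' -> mm_dist (f x) (f x') <= mm_dist x x' &
    forall B, measurable B -> mm_measure Z (f @^-1` B) = mm_measure Y B].
Proof.
have Dk (k : nat) : exists p : (R -> mm_carrier Y) * (R -> mm_carrier Z) * set (measurableTypeR R),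
    [/\ tparam p.1.1, tparam p.1.2, measurable p.2, 1 - k.+1%:R^-1 <= pr (unif R) p.2 &
      forall s t, p.2 s -> p.2 t -> mm_dist (p.1.1 s) (p.1.1 t) <=
        mm_dist (p.1.2 s) (p.1.2 t) + k.+1%:R^-1].
  have [psi [phi [I h]]] := YZ (e := k.+1%:R^-1) ltac:(by rewrite invr_gt0).
  by exists (psi, phi, I).
have [p hp] := choice Dk.
pose psi k := (p k).1.1; pose phi k := (p k).1.2; pose I k := (p k).2.
have hpsi k : tparam (psi k) by case: (hp k).
have hphi k : tparam (phi k) by case: (hp k).
have mI k : measurable (I k) by case: (hp k).
have lI k : 1 - k.+1%:R^-1 <= pr (unif R) (I k) by case: (hp k).
have HI k s t : I k s -> I k t ->
    mm_dist (psi k s) (psi k t) <= mm_dist (phi k s) (phi k t) + k.+1%:R^-1.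
  by case: (hp k) => _ _ _ _; apply.
have [G [GU sG]] := @ultraFilterLemma nat \oo _.
have ev (N : nat) : G [set k | (N <= k)%N] by apply: sG; exists N.
(* [near] and [rel] express that [(x, y)] is a limit, along the ultrafilter, of pairs of parameter
   values; [rel] contains the graph of the future map on [S]. *)
pose near x y r := [set k | exists2 t, I k t & mm_dist x (phi k t) < r /\ mm_dist y (psi k t) < r].
pose rel x y := forall r, 0 < r -> G (near x y r).
have near_dist x y x' y' r r' : G (near x y r) -> G (near x' y' r') ->
    mm_dist y y' <= mm_dist x x' + 2 * r + 2 * r'.
  move=> h h'; apply/ler_addgt0Pr => e /inv_succ_lt[N hN].
  have [k [[Nk [s Is [h1 h2]]] [t It [h3 h4]]]] : [set k | (N <= k)%N] `&` near x y r `&` near x' y' r' !=set0.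
    by apply: (@filter_ex _ G); exact: (filterI (filterI (ev N) h) h').
  have := HI k s t Is It; have := hN k Nk.
  have := mmd_tri y (psi k s) y'; have := mmd_tri (psi k s) (psi k t) y'.
  have := mmd_tri (phi k s) x (phi k t); have := mmd_tri x x' (phi k t).
  rewrite (mmdC (psi k t) y') (mmdC (phi k s) x).
  move: h1 h2 h3 h4; set q := k.+1%:R^-1; lra.
have rel_lip x y x' y' : rel x y -> rel x' y' -> mm_dist y y' <= mm_dist x x'.
  move=> h h'; apply/ler_addgt0Pr => e e0; have e4 : 0 < e / 4 by rewrite divr_gt0.
  by have := near_dist _ _ _ _ _ _ (h _ e4) (h' _ e4); lra.
have [S [mS S1 hS]] := full_support Z.
have near_ex x r : S x -> 0 < r -> exists y, G (near x y r).
  move=> Sx r0; have m0 := hS x r Sx r0.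
  set m := pr _ _ in m0.
  (* The ball around [x] has mass [m] under every [phi k]; the net of [Y] misses less than [m / 2],
     and so does [I k] for large [k]. Some parameter value therefore lies in all three sets. *)
  have m20 : 0 < m / 2 by rewrite divr_gt0.
  have [y [N hN]] := finite_net Y r0 m20.
  set F := [set z | _] in hN.
  have mF : measurable F.
    have -> : F = \bigcup_(i in [set i | (i < N)%N]) oball (y i) r by apply/seteqP; split.
    by apply: bigcup_measurable => i _; exact: oball_measurable.
  have [M hM] := inv_succ_lt m20.
  suff /ultra_pigeonhole[i _ hi] : G [set k | exists2 i, (i < N)%N & near x (y i) r k].
    by exists (y i).
  apply: filterS (ev M) => k Mk.
  have mphi : measurable (phi k @^-1` oball x r : set (measurableTypeR R)) by exact: (law_meas (hphi k) (oball_measurable _ _)).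
  have mpsi : measurable (psi k @^-1` F : set (measurableTypeR R)) by exact: (law_meas (hpsi k) mF).
  have : 0 < pr (unif R) ((phi k @^-1` oball x r `&` psi k @^-1` F) `&` I k).
    have h1 : 1 - (1 - m) <= pr (unif R) (phi k @^-1` oball x r).
      by rewrite (law_pr (hphi k)) -/m; [lra|exact: oball_measurable].
    have h2 : 1 - m / 2 <= pr (unif R) (psi k @^-1` F).
      by rewrite (law_pr (hpsi k) mF) ltW.
    have := prI_ge (measurableI _ _ mphi mpsi) (mI k) (prI_ge mphi mpsi h1 h2) (lI k).
    have := hM k Mk; set q := k.+1%:R^-1; lra.
  move=> /pr_neq0[t [[/= h1 [i iN h2]] It]].
  by exists i => //; exists t.
have rel_ex x : S x -> exists y, rel x y.
  move=> Sx.
  have hj (j : nat) : exists y, G (near x y j.+1%:R^-1).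
    by apply: near_ex => //; rewrite invr_gt0.
  have [y hy] := choice hj.
  have [|l hl] := @mm_complete R Y y.
    move=> e e0; have [N hN] := inv_succ_lt (divr_gt0 e0 (ltr0Sn R 3)).
    exists N => i j Ni Nj; have := near_dist _ _ _ _ _ _ (hy i) (hy j).
    have := hN i Ni; have := hN j Nj; rewrite mmdxx.
    set q := i.+1%:R^-1; set q' := j.+1%:R^-1; lra.
  exists l => r r0; have r20 : 0 < r / 2 by rewrite divr_gt0.
  have [N hN] := inv_succ_lt r20; have [M hM] := hl _ r20.
  apply: filterS (hy (maxn N M)) => k [t It [h1 h2]]; exists t => //.
  have h3 := hN _ (leq_maxl N M); have h4 := hM _ (leq_maxr N M).
  have := mmd_tri l (y (maxn N M)) (psi k t); rewrite (mmdC l (y _)).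
  by move: h1 h2 h3; set q := (maxn N M).+1%:R^-1; split; lra.
pose y0 := mm_inhab Y.
pose f x := if pselect (S x) is left h then projT1 (cid (rel_ex x h)) else y0.
have frel x : S x -> rel x (f x).
  by move=> Sx; rewrite /f; case: pselect => // h; exact: projT2 (cid (rel_ex x h)).
have flip x x' : S x -> S x' -> mm_dist (f x) (f x') <= mm_dist x x'.
  by move=> Sx Sx'; exact: rel_lip (frel _ Sx) (frel _ Sx').
have mf : measurable_fun setT f.
  apply: mm_measurable_fun => U oU.
  pose W := [set z | exists x e, [/\ S x, 0 < e, mm_dist x z < e & forall y, mm_dist (f x) y < e -> U y]].
  have oW : d_open (@mm_dist R Z) W.
    move=> z [x [e [Sx e0 xz he]]]; exists (e - mm_dist x z); first by rewrite subr_gt0.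
    move=> z' zz'; exists x, e; split => //; have := mmd_tri x z z'; lra.
  have -> : f @^-1` U = (S `&` W) `|` (~` S `&` [set _ | U y0]).
    apply/seteqP; split=> x /=.
      have [Sx|nSx] := pselect (S x); last by rewrite /f; case: pselect => // _ ?; right.
      move=> Ux; left; split => //; have [e e0 he] := oU _ Ux.
      by exists x, e; split => //; rewrite mmdxx.
    move=> [[Sx [x' [e [Sx' e0 xx' he]]]]|[nSx Uy]].
      by apply: he; exact: le_lt_trans (flip _ _ Sx' Sx) xx'.
    by rewrite /f; case: pselect.
  apply: measurableU; first by apply: measurableI => //; exact: d_open_measurable.
  apply: measurableI; first exact: measurableC.
  exact: measurable_cst_set.
exists f, S; split => // B mB.
rewrite -(image_lawE (mm_measure Z) mf).
apply: prob_eq mB => e e0.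
(* Transporting [phi k s] through [f] and comparing it with [psi k s] costs at most [7 * r]: [2 * r]
   to reach the net point, [r] for its image, [4 * r] to return in [Y]. *)
pose r := e / 8; have r0 : 0 < r by rewrite divr_gt0.
have e40 : 0 < e / 4 by rewrite divr_gt0.
have [z [N hN]] := finite_net Z r0 e40.
set F := [set x | _] in hN.
have mF : measurable F.
  have -> : F = \bigcup_(i in [set i | (i < N)%N]) oball (z i) r by apply/seteqP; split.
  by apply: bigcup_measurable => i _; exact: oball_measurable.
(* The net points are moved into [S], where [f] is a limit of the approximations. *)
have hx0 i : exists x,
    (exists2 x', S x' & mm_dist (z i) x' < r) -> S x /\ mm_dist (z i) x < r.
  have [[x' h1 h2]|h] := pselect (exists2 x', S x' & mm_dist (z i) x' < r).
    by exists x'.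
  by exists (mm_inhab Z) => /h.
have [x hx] := choice hx0.
have [M hM] := inv_succ_lt r0.
have [k [Mk hk]] : [set k | (M <= k)%N] `&` [set k | forall i, (i < N)%N ->
    (exists2 x', S x' & mm_dist (z i) x' < r) -> near (x i) (f (x i)) r k] !=set0.
  apply: (@filter_ex _ G); apply: (filterI (ev M)); apply: (ultra_finite_inter GU) => i iN.
  have [h|h] := pselect (exists2 x', S x' & mm_dist (z i) x' < r); last first.
    by apply: filterS (ev 0%N) => k _ /h.
  have [Sx _] := hx i h; apply: filterS (frel _ Sx _ r0) => k + _; exact.
exists (f \o phi k), (psi k), (I k `&` phi k @^-1` (F `&` S)).
have mpF : measurable (phi k @^-1` F : set (measurableTypeR R)) by exact: (law_meas (hphi k) mF).
have mpS : measurable (phi k @^-1` S : set (measurableTypeR R)) by exact: (law_meas (hphi k) mS).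
have [mphi lphi] := hphi k.
split.
- split; first exact: (measurableT_comp mf mphi).
  move=> C mC; rewrite image_lawE comp_preimage; apply: lphi.
  by rewrite -[X in measurable X]setTI; exact: mf.
- exact: hpsi.
- by apply: measurableI => //; rewrite preimage_setI; exact: measurableI.
- rewrite preimage_setI.
  have h1 : 1 - e / 4 <= pr (unif R) (phi k @^-1` F) by rewrite (law_pr (hphi k) mF) ltW.
  have h2 : 1 - 0 <= pr (unif R) (phi k @^-1` S) by rewrite (law_pr (hphi k) mS) S1 subr0.
  have := prI_ge (mI k) (measurableI _ _ mpF mpS) (lI k) (prI_ge mpF mpS h1 h2).
  have := hM k Mk; rewrite /r; set q := k.+1%:R^-1; lra.
- move=> s [Is [/= [i iN hi] Ss]] /=.
  have ne : exists2 x', S x' & mm_dist (z i) x' < r by exists (phi k s).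
  have [Sx zx] := hx i ne; have [t It [h1 h2]] := hk i iN ne.
  have h3 := HI k s t Is It; have h4 := hM k Mk; have h5 := flip _ _ Ss Sx.
  have := mmd_tri (phi k s) (z i) (x i); have := mmd_tri (phi k s) (x i) (phi k t).
  have := mmd_tri (f (phi k s)) (f (x i)) (psi k s); have := mmd_tri (f (x i)) (psi k t) (psi k s).
  rewrite (mmdC (phi k s) (z i)) (mmdC (psi k t) (psi k s)).
  move: h4 h3; rewrite /r in h1 h2 zx hi *; set q := k.+1%:R^-1; lra.
Qed.

End compactness.

(** * Pyramids and weak convergence *)

Section dominated.
Variable R : realType.
Notation TR := (measurableTypeR R).
Implicit Types (W X Y Z : mmspace R).

Definition dominated Z W : Prop := forall e, 0 < e -> Dle e W Z.

Lemma Dle_dominated e e' W Y Z : Dle e W Y -> dominated Z Y -> e < e' -> Dle e' W Z.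
Proof.
move=> WY YZ ee'; have h : 0 < (e' - e) / 2 by rewrite divr_gt0// subr_gt0.
by apply: Dle_le (Dle_tri h WY (YZ _ h)); lra.
Qed.

Lemma dominated_Dle e e' W Y Z : dominated Y W -> Dle e Y Z -> e < e' -> Dle e' W Z.
Proof.
move=> WY YZ ee'; have h : 0 < (e' - e) / 2 by rewrite divr_gt0// subr_gt0.
by apply: Dle_le (Dle_tri h (WY _ h) YZ); lra.
Qed.

Lemma Dle_trans_lt e e' e'' W Y Z : Dle e W Y -> Dle e' Y Z -> e + e' < e'' -> Dle e'' W Z.
Proof.
move=> WY YZ ee'; have h : 0 < e'' - (e + e') by rewrite subr_gt0.
by apply: Dle_le (Dle_tri h WY YZ); lra.
Qed.

Lemma Dle0_dominated W Z : Dle 0 W Z -> dominated Z W.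
Proof. by move=> h e e0; apply: Dle_le h; exact: ltW. Qed.

Lemma dominated_trans W Y Z : dominated Y W -> dominated Z Y -> dominated Z W.
Proof.
by move=> WY YZ e e0; apply: (dominated_Dle WY (YZ (e / 2) _)); rewrite ?divr_gt0//; lra.
Qed.

Lemma dominated_refl Z : dominated Z Z.
Proof.
move=> e e0; have [phi hphi] := tparam_exists Z; exists phi, phi, setT; split => //.
  by rewrite prT; lra.
by move=> s t _ _; rewrite lerDl ltW.
Qed.

(** The upper bound is the image of [Z] under [(f, f')] in [Y * Y']. With the maximum metric this
    map stays 1-Lipschitz on a set of full measure, and the projections are nonexpansive everywhere,
    so the dominations of [Y] and [Y'] are exact. The maximum is at least half of the sum metric. *)
Lemma dominated_join Y Y' Z : dominated Z Y -> dominated Z Y' ->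
  exists X, [/\ dominated Z X, lip_dom Y X & lip_dom Y' X].
Proof.
move=> ZY ZY'.
have [f [S [mf mS S1 lf hf]]] := Dle0_lip ZY.
have [f' [S' [mf' mS' S'1 lf' hf']]] := Dle0_lip ZY'.
have mff := measurable_fun_pair mf mf'.
pose B := @mmprod R Y Y' (image_law (mm_measure Z) mff).
pose d' (p q : mm_carrier B) : R := Num.max (mm_dist p.1 q.1) (mm_dist p.2 q.2).
have d'm : is_metric d'.
  split.
  - by move=> p q; rewrite le_max mmd_ge0.
  - move=> [x y] [x' y']; split=> [/= h|[-> ->]]; last by rewrite /d' !mmdxx maxxx.
    have h1 : mm_dist x x' <= 0 by rewrite -h le_max lexx.
    have h2 : mm_dist y y' <= 0 by rewrite -h le_max lexx orbT.
    by congr pair; apply: mmd_eq0; apply/eqP; rewrite eq_le mmd_ge0 andbT.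
  - by move=> p q; rewrite /d' mmdC (mmdC p.2).
  - move=> p q r; rewrite ge_max; apply/andP; split.
      by apply: (le_trans (mmd_tri _ q.1 _)); rewrite lerD// le_max lexx.
    by apply: (le_trans (mmd_tri _ q.2 _)); rewrite lerD// le_max lexx orbT.
have d'l p q : 1 / 2 * Num.min (mm_dist p q) 1 <= d' p q.
  have h1 : mm_dist p.1 q.1 <= d' p q by rewrite le_max lexx.
  have h2 : mm_dist p.2 q.2 <= d' p q by rewrite le_max lexx orbT.
  have : Num.min (mm_dist p q) 1 <= mm_dist p.1 q.1 + mm_dist p.2 q.2 by rewrite ge_min lexx.
  by lra.
have d'u p q : d' p q <= mm_dist p q.
  by rewrite /= /dsum ge_max lerDl lerDr !mmd_ge0.
have tau0 : 0 < 1 / 2 :> R by lra.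
exists (remetric d'm tau0 d'l d'u); split.
- apply: Dle0_dominated; have [th hth] := tparam_exists Z; have [mth lth] := hth.
  have mm : measurable (S `&` S') by exact: measurableI.
  exists (fun s => (f (th s), f' (th s))), th, (th @^-1` (S `&` S')); split => //.
  + split; first exact: (measurableT_comp mff mth).
    move=> C mC; change (unif R (th @^-1` ((fun x => (f x, f' x)) @^-1` C)) =
      mm_measure Z ((fun x => (f x, f' x)) @^-1` C)).
    by apply: lth; rewrite -[X in measurable X]setTI; exact: (mff measurableT C mC).
  + exact: (law_meas hth mm).
  + rewrite (law_pr hth mm) -[X in 1 - X](addr0 0).
    by apply: prI_ge => //; rewrite subr0 ?S1 ?S'1.
  + move=> s t [Ss S's] [St S't]; rewrite addr0 /= /d' /= ge_max.
    by rewrite lf ?lf'.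
- exists fst; split; first by move=> p q; rewrite /= /d' le_max lexx.
  by move=> C mC; exact: hf.
- exists snd; split; first by move=> p q; rewrite /= /d' le_max lexx orbT.
  by move=> C mC; exact: hf'.
Qed.

Lemma dominated_pyramid Z : is_pyramid (dominated Z).
Proof.
split.
- by exists Z; exact: dominated_refl.
- move=> X hX e e0; have e2 : 0 < e / 2 by rewrite divr_gt0.
  have [Y ZY /box_lt[e' /andP[e'0 e'e] /boxle_Dle XY]] := hX _ e2.
  by apply: (Dle_dominated XY ZY); lra.
- by move=> X Y ZX /lip_dom_Dle/Dle0_dominated YX; exact: dominated_trans YX ZX.
- by move=> Y Y' ZY ZY'; have [X [h1 h2 h3]] := dominated_join ZY ZY'; exists X.
Qed.

Definition dpyr Z : pyramid R := exist _ _ (dominated_pyramid Z).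

(** [Dle_shrink] moves [X] to a space dominated by [Z], which belongs to [Q] by downward closure.
    This turns one-sided estimates into box estimates. *)
Lemma pyramid_Dle (Q : pyramid R) X Z e : 0 <= e -> sval Q Z -> Dle e X Z ->
  forall e', e < e' -> exists2 Y, sval Q Y & box X Y < e'.
Proof.
move=> e0 QZ XZ e' ee'; case: Q QZ => Q [neQ clQ dnQ dirQ] /= QZ.
have [|W' W'Z] := @Dle_shrink R e (Num.min ((e' - e) / 2) 1) X Z e0 _ XZ.
  by rewrite lt_min ltr01 ge_min lexx orbT divr_gt0// subr_gt0.
move=> h; exists W'; first exact: dnQ W'Z.
apply: le_lt_trans (le_box _ h) _.
  by rewrite addr_ge0// le_min ler01 divr_ge0// subr_ge0 ltW.
have : Num.min ((e' - e) / 2) 1 <= (e' - e) / 2 by rewrite ge_min lexx.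
lra.
Qed.

Lemma pyramid_dominated (Q : pyramid R) X Z : sval Q Z -> dominated Z X -> sval Q X.
Proof.
move=> QZ ZX; case: (svalP Q) => _ clQ _ _; apply: clQ => e e0.
have e2 : 0 < e / 2 by rewrite divr_gt0.
by apply: (pyramid_Dle (ltW e2) QZ (ZX _ e2)); lra.
Qed.

Lemma pyramid_gap (Q : pyramid R) X : ~ sval Q X ->
  exists2 c : R, 0 < c & forall Z e, sval Q Z -> Dle e X Z -> c <= e.
Proof.
move=> nQX; apply: contrapT => H; apply: nQX; case: (svalP Q) => _ clQ _ _.
apply: clQ => e e0; have e2 : 0 < e / 2 by rewrite divr_gt0.
have [Z [e' [QZ XZ e'e]]] : exists Z e', [/\ sval Q Z, Dle e' X Z & e' < e / 2].
  apply: contrapT => h; apply: H; exists (e / 2) => // Z e' QZ XZ.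
  by rewrite leNgt; apply/negP => ?; apply: h; exists Z, e'.
apply: (pyramid_Dle (ltW e2) QZ (Dle_le (ltW e'e) XZ)); lra.
Qed.

Lemma box_set_lt (Q : pyramid R) X e : box_set X (sval Q) < e ->
  exists2 Y, sval Q Y & box X Y < e.
Proof.
move=> /inf_lt[].
  by case: (svalP Q) => -[Y QY] _ _ _; exists (box X Y), Y.
by move=> _ [Y QY ->] h; exists Y.
Qed.

Lemma box_set_le (Q : pyramid R) X Y : sval Q Y -> box_set X (sval Q) <= box X Y.
Proof.
move=> QY; apply: ge_inf; last by exists Y.
by exists 0 => _ [Z _ ->]; exact: box_ge0.
Qed.

Lemma box_set_ge (Q : pyramid R) X c : (forall Y, sval Q Y -> c <= box X Y) ->
  c <= box_set X (sval Q).
Proof.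
move=> h; apply: lb_le_inf.
  by case: (svalP Q) => -[Y QY] _ _ _; exists (box X Y), Y.
by move=> _ [Y QY ->]; exact: h.
Qed.

Lemma weak_cvg_cst (Q : pyramid R) : weak_cvg (fun=> Q) Q.
Proof.
split=> [X QX e e0|X nQX]; first exists 0%N => n _.
  apply: (le_lt_trans (box_set_le X QX)).
  have e2 : 0 < e / 2 by rewrite divr_gt0.
  have [phi hphi] := tparam_exists X.
  apply: (@le_lt_trans _ _ (e / 2)); last lra.
  apply: le_box; first exact: ltW.
  exists phi, phi, setT; split => //; first by rewrite prT; lra.
  by move=> s t _ _; rewrite subrr normr0 ltW.
have [c c0 hc] := pyramid_gap nQX; exists c => //; exists 0%N => n _.
apply: box_set_ge => Y QY; rewrite leNgt; apply/negP => /box_lt[e /andP[_ ec] /boxle_Dle].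
by move=> /(hc _ _ QY); rewrite leNgt ec.
Qed.

(** A squeeze criterion. From below, the spaces of [P] must be approximated inside [Rn n]. From
    above, a space of [Rn n] may either belong to the convergent [Qn n], which keeps its distance
    from any [X] outside [P], or be almost dominated by [P]. *)
Lemma weak_cvg_crit (Qn Rn : nat -> pyramid R) (P : pyramid R) :
  weak_cvg Qn P ->
  (forall W e, sval P W -> 0 < e -> exists N, forall n, (N <= n)%N ->
    exists2 Z, sval (Rn n) Z & Dle e W Z) ->
  (forall e, 0 < e -> exists N, forall n, (N <= n)%N -> forall V, sval (Rn n) V ->
    sval (Qn n) V \/ exists2 Z, sval P Z & Dle e V Z) ->
  weak_cvg Rn P.
Proof.
move=> [_ QnP] lo up; split=> [X PX e e0|X nPX].
  have e2 : 0 < e / 2 by rewrite divr_gt0.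
  have [N hN] := lo X _ PX e2; exists N => n Nn; have [Z RZ XZ] := hN n Nn.
  have [Y RY XY] := pyramid_Dle (ltW e2) RZ XZ (ltac:(lra) : e / 2 < e).
  exact: le_lt_trans (box_set_le X RY) XY.
have [c c0 hc] := pyramid_gap nPX; have [c' c'0 [N hN]] := QnP X nPX.
(* A space [V] at box distance below [c / 3] from [X] and dominated by [P] up to [c / 3] would put
   [X] within [2 * c / 3] of [P], against the gap [c]. *)
have c2 : 0 < c / 3 by rewrite divr_gt0.
have [M hM] := up _ c2.
exists (Num.min c' (c / 3)); first by rewrite lt_min c'0.
exists (maxn N M) => n; rewrite geq_max => /andP[/hN Nn /hM Mn].
apply: box_set_ge => V /Mn[QV|[Z PZ VZ]].
  by rewrite ge_min (le_trans Nn)// box_set_le.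
rewrite ge_min; apply/orP; right; rewrite leNgt; apply/negP => /box_lt[e /andP[e0 ec] /boxle_Dle XV].
have := hc _ _ PZ (Dle_trans_lt XV VZ (ltac:(lra) : e + c / 3 < e + c / 3 + (c / 3 - e))).
lra.
Qed.

(** If continuity fails at [t], there are points [s n] tending to [t] with [g (s n)] outside [U];
    the squeeze criterion, compared with the constant sequence [g t], shows that they converge
    weakly to [g t]. *)
Lemma weak_path_cont (g : R -> pyramid R) :
  (forall t W e, 0 <= t <= 1 -> sval (g t) W -> 0 < e -> exists2 dl : R, 0 < dl &
    forall s, 0 <= s <= 1 -> `|s - t| < dl -> exists2 Z, sval (g s) Z & Dle e W Z) ->
  (forall t e, 0 <= t <= 1 -> 0 < e -> exists2 dl : R, 0 < dl &
    forall s, 0 <= s <= 1 -> `|s - t| < dl -> forall V, sval (g s) V ->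
      exists2 Z, sval (g t) Z & Dle e V Z) ->
  path_cont (@weak_open R) g.
Proof.
move=> lo up U oU t t01 Ut; apply: contrapT => H.
have Hs (n : nat) : exists s : R, [/\ 0 <= s <= 1, `|s - t| < n.+1%:R^-1 & ~ U (g s)].
  apply: contrapT => h; apply: H; exists n.+1%:R^-1; first by rewrite invr_gt0.
  move=> s s01 st; apply: contrapT => nU; apply: h; by exists s.
have [s hs] := choice Hs.
have [N hN] : exists N : nat, forall n, (N <= n)%N -> U (g (s n)).
  apply: (oU _ Ut); apply: (weak_cvg_crit (weak_cvg_cst (g t))).
    move=> W e tW e0; have [dl dl0 hdl] := lo t W e t01 tW e0.
    have [N hN] := inv_succ_lt dl0; exists N => n Nn; case: (hs n) => s01 st _.
    by apply: hdl => //; exact: lt_trans st (hN n Nn).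
  move=> e e0; have [dl dl0 hdl] := up t e t01 e0.
  have [N hN] := inv_succ_lt dl0; exists N => n Nn V sV; case: (hs n) => s01 st _.
  by right; apply: hdl sV => //; exact: lt_trans st (hN n Nn).
by case: (hs N) => _ _; apply; exact: hN.
Qed.

End dominated.

(** * Joining points by paths inside a set *)

Section joined.
Variables (R : realType) (T : Type) (op : (T -> Prop) -> Prop).

Definition joined (U : T -> Prop) (x y : T) : Prop := exists g : R -> T,
  [/\ path_cont op g, g 0 = x, g 1 = y & forall t, 0 <= t <= 1 -> U (g t)].

Lemma joined_sub (U V : T -> Prop) x y : (forall z, U z -> V z) -> joined U x y -> joined V x y.
Proof. by move=> UV [g [h1 h2 h3 h4]]; exists g; split => // t /h4/UV. Qed.

Lemma joined_sym U x y : joined U x y -> joined U y x.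
Proof.
move=> [g [cg g0 g1 Ug]]; exists (fun t => g (1 - t)); split.
- move=> V oV t t01 Vt; have t01' : 0 <= 1 - t <= 1 by lra.
  have [dl dl0 h] := cg V oV _ t01' Vt; exists dl => // s s01 st.
  apply: h; first lra.
  have -> : 1 - s - (1 - t) = t - s by ring.
  by rewrite distrC.
- by rewrite subr0.
- by rewrite subrr.
- by move=> t t01; apply: Ug; lra.
Qed.

Lemma joined_trans U x y z : joined U x y -> joined U y z -> joined U x z.
Proof.
move=> [g [cg g0 g1 Ug]] [h [ch h0 h1 Uh]].
pose k (t : R) := if t <= 1 / 2 then g (2 * t) else h (2 * t - 1).
have kl t : t <= 1 / 2 -> k t = g (2 * t) by rewrite /k => ->.
have kr t : 1 / 2 <= t -> k t = h (2 * t - 1).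
  rewrite le_eqVlt => /orP[/eqP <-|lt_t]; last by rewrite /k leNgt lt_t.
  by rewrite kl// mulrC divfK// ?pnatr_eq0// g1 subrr h0.
exists k; split.
- move=> V oV t t01 Vt.
  have L : exists2 dl : R, 0 < dl & forall s, 0 <= s <= 1 / 2 -> `|s - t| < dl -> V (k s).
    have [tl|tl] := leP t (1 / 2); last first.
      exists (t - 1 / 2); first lra.
      by move=> s s01; rewrite ltr_norml => /andP[]; lra.
    have [||dl dl0 hdl] := cg V oV (2 * t); [lra|by rewrite -kl|].
    exists (dl / 2); first by rewrite divr_gt0.
    move=> s s01 st; rewrite kl; last lra.
    by apply: hdl; [lra|move: st; rewrite !ltr_norml => /andP[? ?]; apply/andP; split; lra].
  have G : exists2 dl : R, 0 < dl & forall s, 1 / 2 <= s <= 1 -> `|s - t| < dl -> V (k s).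
    have [tl|tl] := leP (1 / 2) t; last first.
      exists (1 / 2 - t); first lra.
      by move=> s s01; rewrite ltr_norml => /andP[]; lra.
    have [||dl dl0 hdl] := ch V oV (2 * t - 1); [lra|by rewrite -kr|].
    exists (dl / 2); first by rewrite divr_gt0.
    move=> s s01 st; rewrite kr; last lra.
    by apply: hdl; [lra|move: st; rewrite !ltr_norml => /andP[? ?]; apply/andP; split; lra].
  have [dl dl0 hL] := L; have [dl' dl'0 hG] := G.
  exists (Num.min dl dl'); first by rewrite lt_min dl0.
  move=> s s01; rewrite lt_min => /andP[h2 h3].
  have [sl|sl] := leP s (1 / 2); [apply: hL => //; lra|apply: hG => //; lra].
- by rewrite kl ?mulr0//; lra.
- by rewrite kr; [rewrite -h1; congr h; lra|lra].
- move=> t t01; have [tl|tl] := leP t (1 / 2).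
    by rewrite kl//; apply: Ug; lra.
  by rewrite kr ?ltW//; apply: Uh; lra.
Qed.

Lemma joined_refl (U : T -> Prop) x : U x -> joined U x x.
Proof.
move=> Ux; exists (fun=> x); split => // V oV t _ Vx.
by exists 1.
Qed.

Lemma lpc_criterion :
  (forall U x, op U -> U x -> op (joined U x)) -> locally_path_connected R op.
Proof.
move=> H x U oU Ux; exists (joined U x); split.
- exact: H.
- exact: joined_refl.
- by move=> y [g [_ _ <- h]]; apply: h; rewrite ler01 lexx.
move=> y z xy xz; have [g [cg g0 g1 Ug]] := joined_trans (joined_sym xy) xz.
exists g; split => // t t01.
(* The initial piece of the path shows that it never leaves the path component. *)
have : joined U y (g t).
  exists (fun s => g (t * s)); split.
  - move=> V oV s s01 Vs.
    have ts01 : 0 <= t * s <= 1.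
      case/andP: t01 => t0 t1; case/andP: s01 => s0 s1.
      by rewrite mulr_ge0//= mulr_ile1.
    have [dl dl0 hdl] := cg V oV _ ts01 Vs; exists dl => // s' s'01 ss'.
    case/andP: t01 => t0 t1; case/andP: s'01 => s'0 s'1.
    apply: hdl; first by rewrite mulr_ge0//= mulr_ile1.
    rewrite -mulrBr normrM ger0_norm//; apply: le_lt_trans ss'.
    by rewrite -[leRHS]mul1r ler_wpM2r.
  - by rewrite mulr0.
  - by rewrite mulr1.
  - move=> s /andP[s0 s1]; case/andP: t01 => t0 t1.
    by apply: Ug; rewrite mulr_ge0//= mulr_ile1.
exact: joined_trans.
Qed.

End joined.

(** * Paths of mm-spaces and pyramids *)

Section linpath.
Variable R : realType.
Notation TR := (measurableTypeR R).
Implicit Types (W X Y Z : mmspace R).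

Lemma tparam_bounded X (phi : R -> mm_carrier X) e : tparam phi -> 0 < e ->
  exists (M : R) (I : set TR), [/\ 0 < M, measurable I, 1 - e <= pr (unif R) I &
    forall s t, I s -> I t -> mm_dist (phi s) (phi t) <= M].
Proof.
move=> hphi e0; pose x0 := mm_inhab X.
pose B (n : nat) := oball x0 n%:R.
have mB n : measurable (B n) by exact: oball_measurable.
have [||n hn] := @pr_full_bigcup _ _ _ (mm_measure X) B e mB _ _ e0.
- by move=> n m nm y; rewrite /B /oball/= => /lt_le_trans; apply; rewrite ler_nat.
- apply/seteqP; split=> // y _; exists (Num.truncn (mm_dist x0 y)).+1 => //.
  exact: truncnS_gt.
exists (2 * n.+1%:R), (phi @^-1` B n); split.
- by rewrite mulr_gt0.
- exact: (law_meas hphi (mB n)).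
- by rewrite (law_pr hphi (mB n)) ltW.
- move=> s t; rewrite /B /oball/= => hs ht.
  have := mmd_tri (phi s) x0 (phi t); rewrite (mmdC (phi s) x0) -natr1; lra.
Qed.

(** The intermediate spaces live on [X * Y] with the law of the pair of parameters. Outside a small
    set both distances are bounded, so the interpolated ones are Lipschitz in [t]; this gives
    continuity in the box sense, ends included, as it is argued on parameters alone. *)
Lemma linpath X Y (phi : R -> mm_carrier X) (psi : R -> mm_carrier Y) :
  tparam phi -> tparam psi -> exists g : R -> mmspace R,
  [/\ g 0 = X, g 1 = Y,
    forall t, 0 <= t <= 1 -> exists zeta : R -> mm_carrier (g t), tparam zeta /\
      forall s s', mm_dist (zeta s) (zeta s') =
        (1 - t) * mm_dist (phi s) (phi s') + t * mm_dist (psi s) (psi s') &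
    forall e, 0 < e -> exists2 dl : R, 0 < dl & forall s t, 0 <= s <= 1 -> 0 <= t <= 1 ->
      `|s - t| < dl -> boxle e (g s) (g t)].
Proof.
move=> hphi hpsi.
have ex (t : R) : exists G : mmspace R, [/\ t = 0 -> G = X, t = 1 -> G = Y &
    0 <= t <= 1 -> exists zeta : R -> mm_carrier G, tparam zeta /\
      forall s s', mm_dist (zeta s) (zeta s') =
        (1 - t) * mm_dist (phi s) (phi s') + t * mm_dist (psi s) (psi s')].
  have [->|t0] := eqVneq t 0.
    exists X; split=> // [/eqP|_]; first by rewrite eq_sym oner_eq0.
    by exists phi; split=> // s s'; rewrite subr0 mul1r mul0r addr0.
  have [->|t1] := eqVneq t 1.
    exists Y; split=> // [/eqP|_]; first by rewrite oner_eq0.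
    by exists psi; split=> // s s'; rewrite subrr mul1r mul0r add0r.
  have [t01|t01] := boolP (0 < t < 1); last first.
    exists X; split=> [//|/eqP|/andP[h0 h1]]; first by rewrite (negbTE t1).
    by move: t01; rewrite !lt_neqAle h0 h1 eq_sym t0 t1.
  case/andP: t01 => t00 t11.
  pose B := mmpair hphi hpsi.
  pose d' (p q : mm_carrier B) : R := (1 - t) * mm_dist p.1 q.1 + t * mm_dist p.2 q.2.
  have t10 : 0 < 1 - t by rewrite subr_gt0.
  have d'm : is_metric d'.
    split.
    - by move=> p q; rewrite addr_ge0// mulr_ge0 ?mmd_ge0// ltW.
    - move=> [x y] [x' y']; split=> [/eqP|[-> ->]]; last by rewrite /d' !mmdxx !mulr0 addr0.
      rewrite /d' paddr_eq0 ?mulr_ge0 ?mmd_ge0 ?ltW//= !mulf_eq0.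
      by rewrite (gt_eqF t10) (gt_eqF t00) /= => /andP[/eqP/mmd_eq0 -> /eqP/mmd_eq0 ->].
    - by move=> p q; rewrite /d' mmdC (mmdC p.2).
    - move=> p q r; rewrite /d' addrACA -!mulrDr.
      by apply: lerD; apply: ler_wpM2l (mmd_tri _ _ _); exact: ltW.
  have tau0 : 0 < Num.min (1 - t) t by rewrite lt_min t10.
  have d'l p q : Num.min (1 - t) t * Num.min (mm_dist p q) 1 <= d' p q.
    apply: (@le_trans _ _ (Num.min (1 - t) t * (mm_dist p.1 q.1 + mm_dist p.2 q.2))).
      by rewrite ler_pM2l// ge_min lexx.
    rewrite mulrDr; apply: lerD; apply: ler_wpM2r; rewrite ?mmd_ge0//.
      by rewrite ge_min lexx.
    by rewrite ge_min lexx orbT.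
  have d'u p q : d' p q <= mm_dist p q.
    apply: lerD; apply: ler_piMl; rewrite ?mmd_ge0 ?(ltW t11)//.
    by rewrite lerBlDr lerDl ltW.
  exists (remetric d'm tau0 d'l d'u); split=> [/eqP|/eqP|_].
  - by rewrite (negbTE t0).
  - by rewrite (negbTE t1).
  - by exists (pairing phi psi); split => //; exact: (pairing_tparam hphi hpsi).
have [g hg] := choice ex; exists g; split.
- by case: (hg 0) => + _ _; apply.
- by case: (hg 1) => _ + _; apply.
- by move=> t t01; case: (hg t) => _ _; apply.
move=> e e0; have e2 : 0 < e / 2 by rewrite divr_gt0.
have [M [I [M0 mI lI hI]]] := tparam_bounded hphi e2.
have [N [J [N0 mJ lJ hJ]]] := tparam_bounded hpsi e2.
have MN0 : 0 < M + N by rewrite addr_gt0.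
exists (e / (M + N)); first by rewrite divr_gt0.
move=> s t s01 t01 st.
have [_ _ /(_ s01)[z [hz dz]]] := hg s; have [_ _ /(_ t01)[z' [hz' dz']]] := hg t.
exists z, z', (I `&` J); split => //; first exact: measurableI.
  by rewrite (splitr e); exact: prI_ge.
move=> u v [Iu Ju] [Iv Jv]; rewrite dz dz'.
have h1 := hI u v Iu Iv; have h2 := hJ u v Ju Jv.
have h3 := mmd_ge0 (phi u) (phi v); have h4 := mmd_ge0 (psi u) (psi v).
set a := mm_dist (phi u) (phi v) in h1 h3 *; set b := mm_dist (psi u) (psi v) in h2 h4 *.
have -> : (1 - s) * a + s * b - ((1 - t) * a + t * b) = (s - t) * (b - a) by ring.
rewrite normrM; apply: (@le_trans _ _ (`|s - t| * (M + N))).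
  apply: ler_wpM2l => //; rewrite ler_norml; apply/andP; split; lra.
by move: st; rewrite ltr_pdivlMr// => /ltW.
Qed.

(** Using [f \o psi] and [psi] as parameters makes one distance pointwise at most the other, so
    every interpolated distance lies between them. *)
Lemma dominated_linpath X Y : lip_dom X Y -> exists g : R -> mmspace R,
  [/\ g 0 = X, g 1 = Y,
    forall t, 0 <= t <= 1 -> dominated (g t) X /\ dominated Y (g t) &
    forall e, 0 < e -> exists2 dl : R, 0 < dl & forall s t, 0 <= s <= 1 -> 0 <= t <= 1 ->
      `|s - t| < dl -> boxle e (g s) (g t)].
Proof.
move=> [f [lf hf]]; have [psi hpsi] := tparam_exists Y.
have mf := nonexpansive_measurable lf.
have hphi : tparam (f \o psi).
  case: hpsi => mpsi lpsi; split; first exact: (measurableT_comp mf mpsi).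
  move=> B mB; rewrite comp_preimage lpsi; first exact: hf.
  by rewrite -[X in measurable X]setTI; exact: mf.
have [g [g0 g1 gz gc]] := linpath hphi hpsi; exists g; split => // t t01.
have [z [hz dz]] := gz t t01; case/andP: t01 => t0 t1.
have key u v : mm_dist (f (psi u)) (f (psi v)) <= mm_dist (psi u) (psi v) by exact: lf.
split; apply: Dle0_dominated.
  exists (f \o psi), z, setT; split => //; first by rewrite prT subr0.
  move=> u v _ _; rewrite addr0 dz /=; have := key u v.
  set a := mm_dist (f _) _; set b := mm_dist _ _ => ab.
  have : 0 <= t * (b - a) by rewrite mulr_ge0// subr_ge0.
  by rewrite mulrBr mulrBl mul1r; lra.
exists z, psi, setT; split => //; first by rewrite prT subr0.
move=> u v _ _; rewrite addr0 dz /=; have := key u v.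
set a := mm_dist (f _) _; set b := mm_dist _ _ => ab.
have : 0 <= (1 - t) * (b - a) by rewrite mulr_ge0// subr_ge0.
by rewrite !mulrBr !mulrBl !mul1r; lra.
Qed.

Lemma linpath_joined X Y (phi : R -> mm_carrier X) (psi : R -> mm_carrier Y)
    (U : pyramid R -> Prop) : tparam phi -> tparam psi ->
  (forall Z (zeta : R -> mm_carrier Z) t, 0 <= t <= 1 -> tparam zeta ->
    (forall s s', mm_dist (zeta s) (zeta s') =
        (1 - t) * mm_dist (phi s) (phi s') + t * mm_dist (psi s) (psi s')) ->
    U (dpyr Z)) ->
  joined R (@weak_open R) U (dpyr X) (dpyr Y).
Proof.
move=> hphi hpsi hU; have [g [g0 g1 gz gc]] := linpath hphi hpsi.
exists (fun t => dpyr (g t)); split; rewrite ?g0 ?g1//; last first.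
  by move=> t t01; have [z [hz dz]] := gz t t01; exact: hU hz dz.
apply: weak_path_cont.
  move=> t W e t01 tW e0; have e2 : 0 < e / 2 by rewrite divr_gt0.
  have [dl dl0 hdl] := gc _ e2; exists dl => // s s01 st.
  exists (g s); first exact: dominated_refl.
  apply: (dominated_Dle tW (boxle_Dle (hdl t s t01 s01 _))); last lra.
  by rewrite distrC.
move=> t e t01 e0; have e2 : 0 < e / 2 by rewrite divr_gt0.
have [dl dl0 hdl] := gc _ e2; exists dl => // s s01 st V sV.
exists (g t); first exact: dominated_refl.
by apply: (dominated_Dle sV (boxle_Dle (hdl s t s01 t01 st))); lra.
Qed.

End linpath.

(** * Monotone paths along an exhausting sequence *)

Section chain.
Variables (R : realType) (Q : pyramid R) (X : nat -> mmspace R).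
Hypotheses (QX : forall m, sval Q (X m)) (XS : forall m, lip_dom (X m) (X m.+1)).
Hypothesis Xdense : forall V e, sval Q V -> 0 < e -> exists m, Dle e V (X m).

Lemma chain_mono m n : (m <= n)%N -> dominated (X n) (X m).
Proof.
elim: n => [|n IH]; first by rewrite leqn0 => /eqP ->; exact: dominated_refl.
rewrite leq_eqVlt => /orP[/eqP ->|]; first exact: dominated_refl.
rewrite ltnS => /IH h; apply: dominated_trans h _.
exact: Dle0_dominated (lip_dom_Dle (XS n)).
Qed.

(** The segments are concatenated to a path [h] on the half-line, which [w t = t / (1 - t)]
    compresses to [[0, 1[]. At time 1 the upper estimate is the inclusion in [Q], and the lower one
    is the density of the sequence. *)
Lemma chain_joined : joined R (@weak_open R)
  (fun P => (forall W, dominated (X 0) W -> sval P W) /\ (forall W, sval P W -> sval Q W))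
  (dpyr (X 0)) Q.
Proof.
have [g hg] := choice (fun m => dominated_linpath (XS m)).
pose h (u : R) := g (Num.truncn u) (u - (Num.truncn u)%:R).
(* At the right end of segment [k] the truncation already equals [k + 1]; the two formulas agree
   because both give [X k.+1]. *)
have hE (k : nat) u : k%:R <= u <= k.+1%:R -> h u = g k (u - k%:R).
  move=> /andP[ku]; rewrite le_eqVlt => /orP[/eqP ->|uk].
    rewrite /h natrK subrr; case: (hg k.+1) => -> _ _ _.
    by case: (hg k) => _ <- _ _; congr g; rewrite -natr1; lra.
  by rewrite /h (@truncn_def _ u k) // ku uk.
have trunc01 (u : R) : 0 <= u -> (Num.truncn u)%:R <= u <= (Num.truncn u).+1%:R.
  by move=> u0; rewrite truncn_le ?u0//= ltW// truncnS_gt.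
have sub01 (u : R) : 0 <= u -> 0 <= u - (Num.truncn u)%:R <= 1.
  by move=> u0; have := trunc01 u u0; rewrite -natr1; lra.
have h_up u : 0 <= u -> dominated (X (Num.truncn u).+1) (h u).
  by move=> u0; case: (hg (Num.truncn u)) => _ _ + _; move=> /(_ _ (sub01 u u0))[].
have h_lo u m : m%:R <= u -> dominated (h u) (X m).
  move=> mu; have u0 : 0 <= u by exact: le_trans mu.
  apply: (@dominated_trans _ _ (X (Num.truncn u))).
    by apply: chain_mono; rewrite truncn_ge_nat.
  by case: (hg (Num.truncn u)) => _ _ + _; move=> /(_ _ (sub01 u u0))[].
have h_cont u e : 0 <= u -> 0 < e -> exists2 dl : R, 0 < dl &
    forall v, 0 <= v -> `|v - u| < dl -> boxle e (h v) (h u).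
  move=> u0 e0; pose m := Num.truncn u.
  have seg k : exists2 dl : R, 0 < dl & forall v, k%:R <= u <= k.+1%:R ->
      k%:R <= v <= k.+1%:R -> `|v - u| < dl -> boxle e (h v) (h u).
    case: (hg k) => _ _ _ /(_ _ e0)[dl dl0 hdl]; exists dl => // v ku kv vu.
    rewrite (hE k u ku) (hE k v kv); apply: hdl.
    - by move: kv; rewrite -natr1; lra.
    - by move: ku; rewrite -natr1; lra.
    - by rewrite opprB addrA subrK.
  (* The segments to the right and to the left of [u]. For [m = 0] the predecessor is harmless,
     since no [v >= 0] lies below [m]. *)
  have [dl1 dl10 h1] := seg m; have [dl2 dl20 h2] := seg m.-1.
  have mu := trunc01 u u0; have um : u < m.+1%:R by exact: truncnS_gt.
  have [dl3 dl30 h3] : exists2 dl : R, 0 < dl & forall v, 0 <= v -> `|v - u| < dl ->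
      v < m%:R -> [/\ m.-1%:R <= u, u <= m.-1.+1%:R & m.-1%:R <= v].
    have [->|um'] := eqVneq u m%:R.
      exists 1 => // v v0; rewrite ltr_norml => /andP[vm _] vm'.
      have m0 : (0 < m)%N by rewrite -(ltr_nat R); exact: le_lt_trans vm'.
      have e1 : m.-1%:R + 1 = m%:R :> R by rewrite natr1 prednK.
      by rewrite prednK//; split; lra.
    exists (u - m%:R); first by rewrite subr_gt0 lt_neqAle eq_sym um'; case/andP: mu.
    by move=> v _; rewrite ltr_norml => /andP[]; lra.
  exists (Num.min (Num.min dl1 dl2) (Num.min dl3 (m.+1%:R - u))).
    by rewrite !lt_min dl10 dl20 dl30 subr_gt0 um.
  move=> v v0; rewrite !lt_min => /andP[/andP[v1 v2] /andP[v3 v4]].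
  have [mv|vm] := leP m%:R v.
    apply: h1 => //; rewrite mv/=; move: v4; rewrite ltr_norml; lra.
  have [h4 h5 h6] := h3 v v0 v3 vm.
  apply: h2 => //; first by rewrite h4.
  rewrite h6/=; apply: le_trans (ltW vm) _; rewrite ler_nat; exact: leqSpred.
have Qh u : 0 <= u -> sval Q (h u).
  by move=> u0; exact: pyramid_dominated (QX _) (h_up u u0).
pose w (t : R) := t / (1 - t).
have w0 t : 0 <= t < 1 -> 0 <= w t by move=> ?; rewrite divr_ge0//; lra.
pose gm (t : R) := if t < 1 then dpyr (h (w t)) else Q.
have gmQ t V : 0 <= t <= 1 -> sval (gm t) V -> sval Q V.
  move=> /andP[t0 _]; rewrite /gm; case: ifPn => // t1.
  by apply: pyramid_dominated; apply: Qh; apply: w0; rewrite t0.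
have w_cont t d : 0 <= t < 1 -> 0 < d -> exists2 dl : R, 0 < dl & forall s, 0 <= s <= 1 ->
    `|s - t| < dl -> s < 1 /\ `|w s - w t| < d.
  move=> t01 d0; pose c := 1 - t; have c0 : 0 < c by rewrite /c; lra.
  (* The first bound keeps [1 - s] above [c / 2]; the second then controls
     [w s - w t = (s - t) / ((1 - s) * c)]. *)
  exists (Num.min (c / 2) (d * (c * c / 2))).
    by rewrite lt_min !divr_gt0// !mulr_gt0// divr_gt0// mulr_gt0.
  move=> s s01; rewrite lt_min => /andP[sc sd].
  have s1 : c / 2 < 1 - s by move: sc; rewrite /c ltr_norml; lra.
  have s10 : 0 < 1 - s by apply: lt_trans s1; rewrite divr_gt0.
  split; first lra.
  have -> : w s - w t = (s - t) / ((1 - s) * c).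
    rewrite /w /c; field; rewrite -/c; apply/andP; split; apply: lt0r_neq0 => //.
  rewrite normrM normfV [X in _ / X]gtr0_norm; last by rewrite mulr_gt0.
  rewrite ltr_pdivrMr; last by rewrite mulr_gt0.
  apply: lt_le_trans sd _; rewrite ler_pM2l//.
  by rewrite -[c * c / 2]mulrAC ler_pM2r// ltW.
have dl_seg t e : 0 <= t < 1 -> 0 < e -> exists2 dl : R, 0 < dl & forall s, 0 <= s <= 1 ->
    `|s - t| < dl -> gm s = dpyr (h (w s)) /\ boxle e (h (w s)) (h (w t)).
  move=> t01 e0; have [d d0 hd] := h_cont _ _ (w0 t t01) e0.
  have [dl dl0 hdl] := w_cont t d t01 d0; exists dl => // s s01 st.
  have [s1 ws] := hdl s s01 st; rewrite /gm s1; split => //.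
  by apply: hd => //; apply: w0; rewrite s1; case/andP: s01 => ->.
exists gm; split.
- apply: weak_path_cont.
    move=> t W e t01 tW e0; have e2 : 0 < e / 2 by rewrite divr_gt0.
    have [t1|t1] := ltP t 1.
      have t01' : 0 <= t < 1 by case/andP: t01 => ->.
      have [dl dl0 hdl] := dl_seg t _ t01' e2; exists dl => // s s01 st.
      have [-> st'] := hdl s s01 st; exists (h (w s)); first exact: dominated_refl.
      move: tW; rewrite /gm t1 => tW.
      by apply: (dominated_Dle tW (boxle_Dle (boxle_sym st'))); lra.
    have QW := gmQ _ _ t01 tW; have [m hm] := Xdense QW e2.
    have tE : t = 1 by apply/eqP; rewrite eq_le t1; case/andP: t01 => _ ->.
    (* If [1 - s < 1 / (m + 1)] then [w s = 1 / (1 - s) - 1] is at least [m], so [h (w s)] dominates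
       [X m]. *)
    exists (m.+1%:R^-1); first by rewrite invr_gt0.
    move=> s s01; rewrite tE distrC => s1; have [sl|sl] := ltP s 1; last first.
      exists W; last exact: dominated_refl.
      by rewrite /gm ltNge sl.
    exists (h (w s)); first by rewrite /gm sl; exact: dominated_refl.
    apply: (Dle_dominated hm (h_lo _ _ _)); last lra.
    rewrite /w ler_pdivlMr ?subr_gt0//.
    have : (1 - s) * m.+1%:R < 1.
      by rewrite -ltr_pdivlMr// div1r; apply: le_lt_trans s1; exact: ler_norm.
    rewrite -natr1; lra.
  move=> t e t01 e0; have e2 : 0 < e / 2 by rewrite divr_gt0.
  have [t1|t1] := ltP t 1.
    have t01' : 0 <= t < 1 by case/andP: t01 => ->.
    have [dl dl0 hdl] := dl_seg t _ t01' e2; exists dl => // s s01 st V.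
    have [-> st'] := hdl s s01 st; rewrite /gm t1 => sV.
    exists (h (w t)); first exact: dominated_refl.
    by apply: (dominated_Dle sV (boxle_Dle st')); lra.
  exists 1 => // s s01 _ V sV; exists V; last exact: dominated_refl.
  by rewrite /gm ltNge t1; exact: gmQ s01 sV.
- rewrite /gm ltr01 /w mul0r /h truncn0 subr0.
  by case: (hg 0%N) => ->.
- by rewrite /gm ltxx.
- move=> t t01; split; last by move=> W; exact: gmQ.
  move=> W XW; rewrite /gm; case: ifPn => t1; last exact: pyramid_dominated (QX 0) XW.
  apply: dominated_trans XW _; apply: h_lo; apply: w0; rewrite t1.
  by case/andP: t01 => ->.
Qed.

End chain.

(** * Separability and exhausting sequences *)

Lemma natr_close (R : realType) (i j : nat) : `|i%:R - j%:R : R| < 1 / 2 -> i = j.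
Proof.
rewrite ltr_norml => /andP[h1 h2]; case: (ltngtP i j) => // ij; exfalso.
  by have : i.+1%:R <= j%:R :> R; [rewrite ler_nat|rewrite -natr1; lra].
by have : j.+1%:R <= i%:R :> R; [rewrite ler_nat|rewrite -natr1; lra].
Qed.

Section separability.
Variable R : realType.
Notation TR := (measurableTypeR R).
Implicit Types (V W X Y Z : mmspace R).

(* Lusin's theorem, applied to the index of a finite net. *)
Lemma tparam_grid V (phi : R -> mm_carrier V) e : tparam phi -> 0 < e ->
  exists (n : nat) (w : nat -> mm_carrier V) (I : set TR),
    [/\ measurable I, 1 - e <= pr (unif R) I &
      forall s, I s -> (Num.truncn (n%:R * s) < n)%N /\
        mm_dist (phi s) (w (Num.truncn (n%:R * s))) <= e].
Proof.
move=> hphi e0; have e2 : 0 < e / 2 by rewrite divr_gt0.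
have [x [N [idx [mi leN ltN mN]]]] := net_index V e2 e2.
pose f (s : R) : R := (idx (phi s))%:R.
have midx i : measurable ([set s | idx (phi s) = i] : set TR) by exact: (law_meas hphi (mi i)).
have mf : measurable_fun (I01 (R := R) : set TR) (f : TR -> TR).
  apply: measurable_funTS => _ B mB; rewrite setTI.
  have -> : f @^-1` B = \bigcup_(i in [set i : nat | B i%:R]) [set s | idx (phi s) = i].
    apply/seteqP; split=> [s /= Bs|s [i /= Bi si]]; last by rewrite /= /f si.
    by exists (idx (phi s)).
  by apply: bigcup_measurable => i _; exact: midx.
have finI : (@lebesgue_measure R (I01 (R := R)) < +oo)%E.
  by rewrite lebesgue_measure_itv/=; case: ifP => _ /=; rewrite ?ltry// -EFinB ltry.
have [K [cK KI mK fK]] := @measurable_almost_continuous R _ (@measurable_I01 R) finI f _ e2 mf.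
have mK' : measurable (K : set TR).
  by apply: closed_measurable; apply: compact_closed => //; exact: Rhausdorff.
(* On the compact set [K] the integer-valued index is continuous, hence locally constant, and by
   compactness constant at a uniform scale. *)
have [n hn] : exists n : nat, forall s t, K s -> K t ->
    `|s - t| < n.+1%:R^-1 -> idx (phi s) = idx (phi t).
  have [|n _ hn] := (iffLR (compact_near_coveringP K)) cK nat \oo
    (fun n s => K s -> forall t, K t -> `|s - t| < n.+1%:R^-1 -> idx (phi s) = idx (phi t)) _.
    move=> s Ks; have /subspace_continuousP/(_ s Ks) := fK.
    move=> /cvgrPdist_lt/(_ (1 / 2) ltac:(lra)); rewrite near_withinE => /nbhs_ballP[d /= d0 hd].
    have [M hM] := inv_succ_lt (divr_gt0 d0 (ltr0Sn R 1)).
    exists (ball s (d / 2), [set n | (M <= n)%N]); first split => /=.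
    - by apply: nbhsx_ballx; rewrite divr_gt0.
    - by exists M.
    move=> [s' n] /= [ss' Mn] Ks' t Kt s't.
    have near_eq u : K u -> `|s - u| < d -> idx (phi s) = idx (phi u).
      move=> Ku su; have := hd u su Ku; rewrite /f; exact: natr_close.
    have hss' : `|s - s'| < d / 2 by exact: ss'.
    have hst : `|s' - t| < d / 2 by apply: lt_trans s't _; exact: hM.
    rewrite -(near_eq s') ?(near_eq t)//; last lra.
    by apply: le_lt_trans (ler_distD s' s t) _; lra.
  by exists n => s t Ks Kt; exact: (hn n (leqnn n) s Ks Ks t Kt).
(* A value of [phi] at some point of [K] in the [j]-th grid interval, and an arbitrary point when
   there is none. *)
pose w (j : nat) := if pselect (exists2 s, K s & Num.truncn (n.+1%:R * s) = j) is left h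
  then phi (projT1 (cid2 h)) else mm_inhab V.
exists n.+1, w, (K `&` [set s | (idx (phi s) < N)%N]).
have mlt : measurable ([set s | (idx (phi s) < N)%N] : set TR).
  have -> : [set s | (idx (phi s) < N)%N] = ~` [set s | idx (phi s) = N].
    apply/seteqP; split=> s /=; first by move=> h h'; move: h; rewrite h' ltnn.
    by move=> /eqP h; rewrite ltn_neqAle h leN.
  by apply: measurableC; exact: midx.
split.
- exact: measurableI.
- rewrite [e](splitr e); apply: prI_ge => //.
    have mIK : measurable (I01 (R := R) `\` K : set TR).
      by apply: measurableD => //; exact: measurable_I01.
    have h : pr (unif R) (I01 (R := R) `\` K) < e / 2.
      by rewrite -lte_fin -prE// unif_leb setIidr.
    have := prU (unif R) mK' mIK; rewrite setUC setDKU// unif_I01; lra.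
  have -> : [set s | (idx (phi s) < N)%N] = ~` [set s | idx (phi s) = N].
    apply/seteqP; split=> s /=; first by move=> h h'; move: h; rewrite h' ltnn.
    by move=> /eqP h; rewrite ltn_neqAle h leN.
  rewrite prC// lerD2l lerN2; rewrite [leLHS](law_pr hphi (mi N)); exact: ltW.
move=> s [Ks sN]; have := KI s Ks; rewrite /I01/= in_itv/= => /andP[s0 s1]; split.
  by rewrite truncn_lt_nat ?mulr_ge0// -[ltRHS]mulr1 ltr_pM2l.
rewrite /w; case: pselect => [h|]; last by case; exists s.
case: (cid2 h) => t /= Kt ts.
have st : idx (phi s) = idx (phi t).
  apply: hn => //; have := KI t Kt; rewrite /I01/= in_itv/= => /andP[t0 t1].
  have c0 : 0 < n.+1%:R :> R by [].
  move: c0 ts; set c : R := n.+1%:R => c0 ts.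
  have /andP[h1 h2] := truncn_itv (mulr_ge0 (ltW c0) s0).
  have := truncn_itv (mulr_ge0 (ltW c0) t0).
  rewrite ts -natr1 => /andP[h3 h4]; rewrite -natr1 in h2.
  rewrite -[ltRHS]mulr1 ltr_pdivlMl// -[X in X * _](ger0_norm (ltW c0)).
  by rewrite -normrM mulrBr ltr_norml; apply/andP; split; lra.
have h1 := ltN _ sN; have h2 := ltN (phi t); rewrite -st in h2; have h3 := h2 sN.
have := mmd_tri (phi s) (x (idx (phi s))) (phi t); rewrite (mmdC (phi s) (x _)); lra.
Qed.

End separability.

Section dense_sequence.
Variable R : realType.
Notation TR := (measurableTypeR R).
Implicit Types (V W X Y Z : mmspace R).

(* [(k, n, q)] records the distances between the [n] grid values of a
   parameter of [V], rounded down to multiples of [1/(k+1)]. *)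
Definition has_code (k n : nat) (q : seq nat) V : Prop :=
  exists (phi : R -> mm_carrier V) (w : nat -> mm_carrier V) (I : set TR),
    [/\ tparam phi, measurable I, 1 - k.+1%:R^-1 <= pr (unif R) I,
      forall s, I s -> (Num.truncn (n%:R * s) < n)%N /\
        mm_dist (phi s) (w (Num.truncn (n%:R * s))) <= k.+1%:R^-1 &
      forall i j, (i < n)%N -> (j < n)%N ->
        Num.truncn (k.+1%:R * mm_dist (w i) (w j)) = nth 0%N q (i * n + j)].

Lemma has_code_ex k V : exists n q, has_code k n q V.
Proof.
have [phi hphi] := tparam_exists V.
have [n [w [I [mI lI hI]]]] := tparam_grid hphi (ltac:(by rewrite invr_gt0) : 0 < k.+1%:R^-1).
exists n, (mkseq (fun a => Num.truncn (k.+1%:R * mm_dist (w (a %/ n)%N) (w (a %% n)%N))) (n * n)).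
exists phi, w, I; split => // i j iN jN.
have n0 : (0 < n)%N by exact: leq_ltn_trans iN.
rewrite nth_mkseq ?divnMDl// ?(divn_small jN) ?addn0 ?modnMDl ?(modn_small jN)//.
apply: (@leq_trans (i * n + n)); first by rewrite ltn_add2l.
by rewrite -mulSnr leq_mul2r iN orbT.
Qed.

Lemma has_code_boxle k n q V W : has_code k n q V -> has_code k n q W ->
  boxle (5 * k.+1%:R^-1) V W.
Proof.
move=> [phi [v [I [hphi mI lI hI hv]]]] [psi [w [J [hpsi mJ lJ hJ hw]]]].
exists phi, psi, (I `&` J); split => //; first exact: measurableI.
  have := prI_ge mI mJ lI lJ; have : 0 < k.+1%:R^-1 :> R by rewrite invr_gt0.
  set r := k.+1%:R^-1; lra.
move=> s t [Is Js] [It Jt].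
have [sn h1] := hI s Is; have [tn h2] := hI t It.
have [_ h3] := hJ s Js; have [_ h4] := hJ t Jt.
set i := Num.truncn (n%:R * s) in sn h1 h3; set j := Num.truncn (n%:R * t) in tn h2 h4.
have k0 : 0 < k.+1%:R :> R by [].
have h5 := truncn_itv (mulr_ge0 (ltW k0) (mmd_ge0 (v i) (v j))).
have h6 := truncn_itv (mulr_ge0 (ltW k0) (mmd_ge0 (w i) (w j))).
have h7 : `|mm_dist (v i) (v j) - mm_dist (w i) (w j)| <= k.+1%:R^-1.
  rewrite -[leRHS]mulr1 ler_pdivlMl// -[X in X * _](ger0_norm (ltW k0)) -normrM mulrBr.
  move: h5 h6; rewrite (hv i j sn tn) (hw i j sn tn) -!(natr1 (nth 0%N q (i * n + j))).
  by rewrite ler_norml => /andP[? ?] /andP[? ?]; apply/andP; split; lra.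
have h8 := mmd_lip2 (phi s) (phi t) (v i) (v j).
have h9 := mmd_lip2 (psi s) (psi t) (w i) (w j).
move: h1 h2 h3 h4 h7 h8 h9; set r := k.+1%:R^-1; rewrite !ler_norml.
move=> ? ? ? ? /andP[? ?] /andP[? ?] /andP[? ?]; apply/andP; split; lra.
Qed.

(** There are countably many codes; for each one realized in [P], a space of [P] realizing it is
    chosen. *)
Lemma boxle_dense (P : mmspace R -> Prop) X0 : P X0 -> exists W : nat -> mmspace R,
  (forall j, P (W j)) /\ forall V e, P V -> 0 < e -> exists j, boxle e V (W j).
Proof.
move=> PX0.
have ex (j : nat) : exists W, P W /\ let: (k, n, q) := odflt (0%N, 0%N, [::]) (unpickle j) in
    forall V, P V -> has_code k n q V -> has_code k n q W.
  case: (odflt _ _) => -[k n] q.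
  have [[V [PV hV]]|h] := pselect (exists V, P V /\ has_code k n q V); first by exists V.
  by exists X0; split => // V PV hV; exfalso; apply: h; exists V.
have [W hW] := choice ex; exists W; split => [j|V e PV e0]; first by case: (hW j).
have [k hk] := inv_succ_lt (divr_gt0 e0 (ltr0Sn R 4)).
have [n [q hV]] := has_code_ex k V; exists (pickle (k, n, q)).
case: (hW (pickle (k, n, q))) => _; rewrite pickleK/= => /(_ V PV hV) hW'.
apply: boxle_le (has_code_boxle hV hW').
by have := hk k (leqnn k); set r := k.+1%:R^-1; lra.
Qed.

(** By directedness the next term is chosen above both the current one and the next space of a dense
    sequence in [Q]. *)
Lemma pyramid_chain (Q : pyramid R) X0 : sval Q X0 -> exists X : nat -> mmspace R,
  [/\ X 0 = X0, forall m, sval Q (X m), forall m, lip_dom (X m) (X m.+1) &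
    forall V e, sval Q V -> 0 < e -> exists m, Dle e V (X m)].
Proof.
move=> QX0; have [W [QW hW]] := boxle_dense QX0.
have ex (p : nat * mmspace R) : exists X', sval Q p.2 ->
    [/\ sval Q X', lip_dom p.2 X' & lip_dom (W p.1) X'].
  have [Qp|nQ] := pselect (sval Q p.2); last by exists X0.
  case: (svalP Q) => _ _ _ dirQ; have [X' QX' [h1 h2]] := dirQ _ _ Qp (QW p.1).
  by exists X'.
have [S hS] := choice ex.
pose X := fix X m := if m is m'.+1 then S (m', X m') else X0.
have QX m : sval Q (X m) by elim: m => [//|m IH]; case: (hS (m, X m) IH).
exists X; split => //; first by move=> m; case: (hS (m, X m) (QX m)).
move=> V e QV e0; have e2 : 0 < e / 2 by rewrite divr_gt0.
have [j /boxle_Dle hj] := hW V _ QV e2; exists j.+1.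
case: (hS (j, X j) (QX j)) => _ _ /lip_dom_Dle/Dle0_dominated h.
by apply: (Dle_dominated hj h); lra.
Qed.

Lemma pyramid_joined (Q : pyramid R) X : sval Q X -> joined R (@weak_open R)
  (fun P => sval P X /\ (forall W, sval P W -> sval Q W)) (dpyr X) Q.
Proof.
move=> /pyramid_chain[Y [Y0 QY YS Yd]].
rewrite -Y0; apply: joined_sub (chain_joined QY YS Yd) => P [h1 h2]; split => //.
exact/h1/dominated_refl.
Qed.

End dense_sequence.

(** * Local path connectedness of the space of pyramids *)

Section weak_topology.
Variable R : realType.

(** Otherwise, along a subsequence, every path from [Qn (n k)] to [Q] leaves [U]. Exit points [P k]
    on the constructed paths are squeezed between convergent sequences, so they converge to [Q], and
    openness of [U] puts them back in [U]. *)
Lemma weak_open_cvg_joined (U : pyramid R -> Prop) (Q : pyramid R) (Qn : nat -> pyramid R) :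
  weak_open U -> U Q -> weak_cvg Qn Q ->
  exists N, forall n, (N <= n)%N -> joined R (@weak_open R) U (Qn n) Q.
Proof.
move=> oU UQ cQ; apply: contrapT => H.
have bad N : exists2 n, (N <= n)%N & ~ joined R (@weak_open R) U (Qn n) Q.
  apply: contrapT => h; apply: H; exists N => n Nn; apply: contrapT => nj.
  by apply: h; exists n.
have [X0 QX0] : exists X, sval Q X by case: (svalP Q).
have [X [_ QX XS Xd]] := pyramid_chain QX0.
have sub k : exists n, [/\ (k <= n)%N, ~ joined R (@weak_open R) U (Qn n) Q &
    exists2 Y, sval (Qn n) Y & boxle k.+1%:R^-1 (X k) Y].
  case: cQ => lo _; have [N hN] := lo _ (QX k) (k.+1%:R^-1) ltac:(by rewrite invr_gt0).
  have [n hn nj] := bad (maxn N k); exists n.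
  move: hn; rewrite geq_max => /andP[/hN Nn kn]; split => //.
  have [Y QY /box_lt[e /andP[_ ek] h]] := box_set_lt Nn.
  by exists Y => //; exact: boxle_le (ltW ek) h.
have [n hn] := choice sub.
have cQ' : weak_cvg (Qn \o n) Q.
  case: cQ => lo up; split=> [V QV e e0|V nQV].
    have [N hN] := lo V QV e e0; exists N => k Nk; apply: hN.
    by case: (hn k) => kn _ _; exact: leq_trans kn.
  have [c c0 [N hN]] := up V nQV; exists c => //; exists N => k Nk; apply: hN.
  by case: (hn k) => kn _ _; exact: leq_trans kn.
(* What holds all along the [k]-th path. The factor 2 leaves room for the strict inequality required
   when dominations are composed. *)
pose Good k (P : pyramid R) := (exists2 Z, sval P Z & Dle k.+1%:R^-1 (X k) Z) /\
  forall V, sval P V -> sval (Qn (n k)) V \/ exists2 Z, sval Q Z & Dle (2 * k.+1%:R^-1) V Z.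
have r0 k : 0 < k.+1%:R^-1 :> R by rewrite invr_gt0.
have path k : joined R (@weak_open R) (Good k) (Qn (n k)) Q.
  case: (hn k) => _ _ [Y QY XY].
  apply: (@joined_trans _ _ _ _ _ (dpyr Y)).
    apply/joined_sym; apply: joined_sub (pyramid_joined QY) => P [PY PQ]; split.
      by exists Y => //; exact: boxle_Dle XY.
    by move=> V /PQ; left.
  apply: (@joined_trans _ _ _ _ _ (dpyr (X k))); last first.
    apply: joined_sub (pyramid_joined (QX k)) => P [PX PQ]; split.
      by exists (X k) => //; exact: dominated_refl.
    by move=> V /PQ QV; right; exists V => //; apply: dominated_refl; rewrite mulr_gt0.
  have [phi [psi [I [hphi hpsi mI lI hI]]]] := XY.
  apply: (linpath_joined hpsi hphi) => Z zeta t /andP[t0 t1] hz dz.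
  (* The distance of the intermediate space to [X k] is the error of [Y] multiplied by [1 - t]. *)
  have key s s' : I s -> I s' -> `|mm_dist (phi s) (phi s') - mm_dist (zeta s) (zeta s')| <= k.+1%:R^-1.
    move=> Is Is'; have := hI s s' Is Is'; rewrite dz.
    set a := mm_dist (phi s) _; set b := mm_dist (psi s) _ => ab.
    have -> : a - ((1 - t) * b + t * a) = (1 - t) * (a - b) by ring.
    rewrite normrM ger0_norm ?subr_ge0//; apply: le_trans ab.
    by apply: ler_piMl => //; rewrite lerBlDr lerDl.
  have XZ : boxle k.+1%:R^-1 (X k) Z by exists phi, zeta, I.
  split; first by exists Z; [exact: dominated_refl|exact: boxle_Dle].
  move=> V ZV; right; exists (X k) => //.
  apply: (dominated_Dle ZV (boxle_Dle (boxle_sym XZ))).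
  by have := r0 k; set r := k.+1%:R^-1; lra.
have out k : exists P, Good k P /\ ~ U P.
  have [g [cg g0 g1 hg]] := path k; case: (hn k) => _ nj _.
  apply: contrapT => h; apply: nj; exists g; split => // t t01.
  by apply: contrapT => nU; apply: h; exists (g t); split => //; exact: hg.
have [P hP] := choice out.
have [N hN] : exists N, forall k, (N <= k)%N -> U (P k).
  apply: (oU _ UQ); apply: (weak_cvg_crit cQ').
    move=> W e QW e0; have e3 : 0 < e / 3 by rewrite divr_gt0.
    have [m Wm] := Xd W _ QW e3; have [M hM] := inv_succ_lt e3.
    exists (maxn m M) => k; rewrite geq_max => /andP[mk Mk].
    case: (hP k) => -[[Z PZ XZ] _] _; exists Z => //.
    have Wk : Dle (e / 3 + e / 6) W (X k).
      by apply: (Dle_dominated Wm (chain_mono XS mk)); lra.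
    apply: (Dle_trans_lt Wk XZ).
    by have := hM k Mk; set r := k.+1%:R^-1; lra.
  move=> e e0; have [M hM] := inv_succ_lt (divr_gt0 e0 (ltr0Sn R 1)).
  exists M => k Mk V PV; case: (hP k) => -[_ up] _; have [|[Z QZ VZ]] := up V PV.
    by left.
  right; exists Z => //; apply: Dle_le VZ.
  by have := hM k Mk; set r := k.+1%:R^-1; lra.
by case: (hP N) => _; apply; exact: hN.
Qed.

Lemma weak_locally_path_connected : locally_path_connected R (@weak_open R).
Proof.
apply: lpc_criterion => U x oU Ux Q xQ Qn cQ.
have UQ : U Q by have [g [_ _ <- h]] := xQ; apply: h; rewrite ler01 lexx.
have [N hN] := weak_open_cvg_joined oU UQ cQ; exists N => n Nn.
exact: joined_trans xQ (joined_sym (hN n Nn)).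
Qed.

End weak_topology.

(** * The concentration topology *)

Section hausdorff_facts.
Variables (R : realType) (T : Type) (dd : T -> T -> R).
Hypothesis dd0 : forall u v, 0 <= dd u v.

Lemma hausdorff_le (A B : set T) (e : R) : A !=set0 -> B !=set0 ->
  (forall u, A u -> exists2 v, B v & dd u v <= e) ->
  (forall v, B v -> exists2 u, A u & dd u v <= e) -> hausdorff dd A B <= e.
Proof.
move=> [a Aa] [b Bb] AB BA; rewrite ge_max; apply/andP; split; apply: ge_sup.
- by exists (inf [set dd a v | v in B]), a.
- move=> _ [u Au <-]; have [v Bv uv] := AB u Au; apply: le_trans uv.
  by apply: ge_inf; [exists 0 => _ [w _ <-]|exists v].
- by exists (inf [set dd u b | u in A]), b.
- move=> _ [v Bv <-]; have [u Au uv] := BA v Bv; apply: le_trans uv.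
  by apply: ge_inf; [exists 0 => _ [w _ <-]|exists u].
Qed.

Hypothesis dd1 : forall u v, dd u v <= 1.

(** The bound [dd1] makes the suprema in [hausdorff] genuine upper bounds; the supremum of an
    unbounded set is [0] by convention. *)
Lemma hausdorff_lt (A B : set T) (e : R) : A !=set0 -> B !=set0 -> hausdorff dd A B < e ->
  (forall u, A u -> exists2 v, B v & dd u v < e) /\
  (forall v, B v -> exists2 u, A u & dd u v < e).
Proof.
move=> A0 B0; rewrite gt_max => /andP[h1 h2]; split=> [u Au|v Bv].
  have [||_ [v Bv <-] h] := @inf_lt R [set dd u v | v in B] e; last by exists v.
    by case: B0 => b Bb; exists (dd u b), b.
  apply: le_lt_trans h1; apply: ub_le_sup; last by exists u.
  exists 1 => _ [w _ <-]; case: B0 => b Bb; apply: le_trans (dd1 w b).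
  by apply: ge_inf; [exists 0 => _ [z _ <-]|exists b].
have [||_ [u Au <-] h] := @inf_lt R [set dd u v | u in A] e; last by exists u.
  by case: A0 => a Aa; exists (dd a v), a.
apply: le_lt_trans h2; apply: ub_le_sup; last by exists v.
exists 1 => _ [w _ <-]; case: A0 => a Aa; apply: le_trans (dd1 a w).
by apply: ge_inf; [exists 0 => _ [z _ <-]|exists a].
Qed.

End hausdorff_facts.

Section concentration.
Variable R : realType.
Notation TR := (measurableTypeR R).
Implicit Types (W X Y Z : mmspace R).

Definition close_off (e : R) (u v : R -> R) : Prop := exists I : set TR,
  [/\ measurable I, 1 - e <= pr (unif R) I & forall s, I s -> `|u s - v s| <= e].

Lemma close_sym e u v : close_off e u v -> close_off e v u.
Proof. by move=> [I [h1 h2 h3]]; exists I; split => // s /h3; rewrite distrC. Qed.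

Lemma dKF_ge0 (u v : R -> R) : 0 <= dKF u v.
Proof. by apply: inf_nneg => x []. Qed.

Lemma dKF_close e u v : 0 <= e -> close_off e u v -> dKF u v <= e.
Proof.
move=> e0 [I [mI lI hI]]; apply: ge_inf; first by exists 0 => x [].
split=> //; apply: (@le_trans _ _ (leb (I01 (R := R) `&` ~` I))).
  apply: le_outer_measure => s [Is /= us]; split => // Iss.
  by move: us; rewrite ltNge hI.
have mC : measurable (~` I) by exact: measurableC.
rewrite -unif_leb prE// lee_fin prC//; lra.
Qed.

Lemma dKF_le1 (u v : R -> R) : dKF u v <= 1.
Proof.
apply: dKF_close => //; exists set0; split => //; by rewrite subrr pr_ge0.
Qed.

(** The Lipschitz hypotheses make the set of large deviation measurable; its complement is the good
    set. *)
Lemma dKF_lt e X Y (phi : R -> mm_carrier X) (psi : R -> mm_carrier Y)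
    (f : mm_carrier X -> R) (g : mm_carrier Y -> R) :
  parameter phi -> parameter psi -> lip1 f -> lip1 g ->
  dKF (f \o phi) (g \o psi) < e -> close_off e (f \o (phi \o @clamp R)) (g \o (psi \o @clamp R)).
Proof.
move=> hphi hpsi lf lg /inf_lt[].
  exists 1; split => //=; apply: (@le_trans _ _ (leb (I01 (R := R)))).
    by apply: le_outer_measure => s [].
  by rewrite -[X in leb X]setIT -unif_leb probability_setT.
move=> e' [e'0 he'] e'e.
have mf : measurable_fun [set: TR] ((f \o (phi \o @clamp R)) : TR -> TR).
  by apply: measurableT_comp; [exact: lip1_measurable|case: (param_tparam hphi)].
have mg : measurable_fun [set: TR] ((g \o (psi \o @clamp R)) : TR -> TR).
  by apply: measurableT_comp; [exact: lip1_measurable|case: (param_tparam hpsi)].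
pose B : set TR := [set s | e' < `|f (phi (clamp s)) - g (psi (clamp s))|].
have mB : measurable B.
  have mfg := @measurable_funB _ TR R setT _ _ mf mg.
  have mn := measurableT_comp (@normr_measurable R setT) mfg.
  have := mn measurableT `]e', +oo[%classic (measurable_itv _); rewrite setTI.
  by congr (measurable _); apply/seteqP; split=> s; rewrite /B /= in_itv/= andbT.
exists (~` B); split; first exact: measurableC.
  rewrite prC// lerD2l lerN2; apply: le_trans (ltW e'e); rewrite -lee_fin -prE// unif_leb.
  apply: le_trans he'; apply: le_outer_measure => s [Is]; rewrite /B /= clampE//.
by move=> s /= /negP; rewrite -leNgt => /le_trans; apply; exact: ltW.
Qed.

Definition concle (e : R) X Y : Prop :=
  exists (phi : R -> mm_carrier X) (psi : R -> mm_carrier Y),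
    [/\ tparam phi, tparam psi,
      forall f, lip1 f -> exists2 g, lip1 g & close_off e (f \o phi) (g \o psi) &
      forall g, lip1 g -> exists2 f, lip1 f & close_off e (f \o phi) (g \o psi)].

Lemma lip1_cst X (c : R) : lip1 (fun _ : mm_carrier X => c).
Proof. by move=> x y; rewrite subrr normr0 mmd_ge0. Qed.

Lemma lipcomp_neq0 X (phi : R -> mm_carrier X) : lipcomp phi !=set0.
Proof. by eexists; exists (fun=> 0); [exact: lip1_cst|]. Qed.

Lemma dconc_concle e X Y : 0 <= e -> concle e X Y -> dconc X Y <= e.
Proof.
move=> e0 [phi [psi [hphi hpsi XY YX]]].
apply: (@le_trans _ _ (hausdorff (@dKF R) (lipcomp phi) (lipcomp psi))).
  apply: ge_inf; last by exists phi, psi; split => //; exact: tparam_param.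
  exists 0 => _ [p [q [_ _ ->]]]; rewrite le_max; apply/orP; left.
  have [u Au] := lipcomp_neq0 p; apply: (@le_trans _ _ (inf [set dKF u v | v in lipcomp q])).
    by apply: inf_nneg => _ [v _ <-]; exact: dKF_ge0.
  apply: ub_le_sup; last by exists u.
  exists 1 => _ [w _ <-]; have [b Bb] := lipcomp_neq0 q; apply: le_trans (dKF_le1 w b).
  by apply: ge_inf; [exists 0 => _ [z _ <-]; exact: dKF_ge0|exists b].
apply: hausdorff_le; [exact: dKF_ge0|exact: lipcomp_neq0|exact: lipcomp_neq0| |].
  move=> _ [f lf <-]; have [g lg h] := XY f lf; exists (g \o psi); first by exists g.
  exact: dKF_close.
move=> _ [g lg <-]; have [f lf h] := YX g lg; exists (f \o phi); first by exists f.
exact: dKF_close.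
Qed.

Lemma dconc_lt e X Y : dconc X Y < e -> concle e X Y.
Proof.
move=> /inf_lt[].
  have [phi hphi] := tparam_exists X; have [psi hpsi] := tparam_exists Y.
  by eexists; exists phi, psi; split; [exact: tparam_param..|reflexivity].
move=> _ [phi [psi [hphi hpsi ->]]] h.
have [h1 h2] := hausdorff_lt dKF_ge0 dKF_le1 (lipcomp_neq0 phi) (lipcomp_neq0 psi) h.
exists (phi \o @clamp R), (psi \o @clamp R); split.
- exact: param_tparam.
- exact: param_tparam.
- move=> f lf; have [|_ [g lg <-] fg] := h1 (f \o phi); first by exists f.
  by exists g => //; exact: dKF_lt fg.
- move=> g lg; have [|_ [f lf <-] fg] := h2 (g \o psi); first by exists g.
  by exists f => //; exact: dKF_lt fg.
Qed.

Lemma lip1_transfer X (psi : R -> mm_carrier X) (h : R -> R) (I : set TR) e :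
  0 <= e -> measurable I -> 1 - e <= pr (unif R) I ->
  (forall s t, I s -> I t -> h s - h t <= mm_dist (psi s) (psi t) + e) ->
  exists2 g : mm_carrier X -> R, lip1 g & close_off e h (g \o psi).
Proof.
move=> e0 mI lI H; have [g lg hg] := mcshane H; exists g => //; exists I; split => // s Is.
have /andP[h1 h2] := hg s Is; rewrite /= ger0_norm ?subr_ge0//; lra.
Qed.

Lemma boxle_concle e X Y : 0 <= e -> boxle e X Y -> concle e X Y.
Proof.
move=> e0 [phi [psi [I [hphi hpsi mI lI hI]]]]; exists phi, psi; split => // f lf.
  apply: (@lip1_transfer Y psi (f \o phi) I) => // s t Is It /=.
  have := hI s t Is It; rewrite ler_norml => /andP[_ h].
  have := lf (phi s) (phi t); rewrite ler_norml => /andP[_]; lra.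
have [||||g lg h] := @lip1_transfer X phi (f \o psi) I e => //.
  move=> s t Is It /=; have := hI s t Is It; rewrite ler_norml => /andP[h _].
  have := lf (psi s) (psi t); rewrite ler_norml => /andP[_]; lra.
by exists g => //; exact: close_sym.
Qed.

Lemma finite_pr_inter (N : nat) (c : R) (Q : nat -> R -> R -> Prop) : 0 <= c ->
  (forall i, (i < N)%N -> exists E : set TR, [/\ measurable E, 1 - c <= pr (unif R) E &
    forall s t, E s -> E t -> Q i s t]) ->
  exists J : set TR, [/\ measurable J, 1 - N%:R * c <= pr (unif R) J &
    forall i s t, (i < N)%N -> J s -> J t -> Q i s t].
Proof.
move=> c0; elim: N => [|N IH] H.
  by exists setT; split => //; rewrite prT mul0r subr0.
have [|J [mJ lJ hJ]] := IH; first by move=> i iN; apply: H; exact: ltnW.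
have [E [mE lE hE]] := H N (ltnSn N).
exists (J `&` E); split; first exact: measurableI.
  by rewrite -natr1 mulrDl mul1r; exact: prI_ge.
move=> i s t; rewrite ltnS leq_eqVlt => /orP[/eqP ->|iN] [Js Es] [Jt Et]; first exact: hE.
exact: hJ.
Qed.

(** [H] is the distance to the image of [K] under [psi]. *)
Lemma set_dist X (K : set R) (psi : R -> mm_carrier X) : K !=set0 ->
  exists H : mm_carrier X -> R, [/\ lip1 H, forall s, K s -> H (psi s) <= 0 &
    forall x e, 0 < e -> exists2 s, K s & mm_dist (psi s) x < H x + e].
Proof.
move=> [k0 Kk0]; pose A x := [set mm_dist (psi s) x | s in K].
have hA x : has_inf (A x).
  by split; [exists (mm_dist (psi k0) x), k0|exists 0 => _ [s _ <-]; exact: mmd_ge0].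
have half x y : inf (A x) - inf (A y) <= mm_dist x y.
  rewrite lerBlDr addrC -lerBlDr; apply: lb_le_inf; first by case: (hA y).
  move=> _ [s Ks <-]; rewrite lerBlDr.
  apply: (@le_trans _ _ (mm_dist (psi s) x)); last by rewrite (mmdC x y); exact: mmd_tri.
  by apply: ge_inf; [case: (hA x)|exists s].
exists (fun x => inf (A x)); split.
- by move=> x y; rewrite ler_norml lerNl opprB half mmdC half.
- move=> s Ks; apply: ge_inf; first by case: (hA (psi s)).
  by exists s => //; rewrite mmdxx.
- move=> x e e0; have [_ [s Ks <-] h] := inf_adherent e0 (hA x).
  by exists s.
Qed.

(* [dl] must be small compared to the masses of the cells of a finite net of [Y]:
   two sets of mass [1 - dl] then meet in every cell. *)
Lemma conc_stable Y e : 0 < e -> exists2 dl : R, 0 < dl &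
  forall X (phi : R -> mm_carrier Y) (psi : R -> mm_carrier X),
    tparam phi -> tparam psi ->
    (forall f, lip1 f -> exists2 g, lip1 g & close_off dl (f \o phi) (g \o psi)) ->
    (forall g, lip1 g -> exists2 f, lip1 f & close_off dl (f \o phi) (g \o psi)) ->
    forall Z (zeta : R -> mm_carrier Z), tparam zeta ->
    (forall s t, Num.min (mm_dist (phi s) (phi t)) (mm_dist (psi s) (psi t)) <=
       mm_dist (zeta s) (zeta t) <=
       Num.max (mm_dist (phi s) (phi t)) (mm_dist (psi s) (psi t))) ->
    concle e Y Z.
Proof.
(* Six [eta] bound the oscillation of a function on a cell, seven bound the excess of the distance
   from a cell. *)
move=> e0; pose eta := e / 13; have eta0 : 0 < eta by rewrite divr_gt0.
have [x [N [idx [mi leN ltN mN]]]] := net_index Y eta0 eta0.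
pose m i := pr (mm_measure Y) [set y | idx y = i].
(* The least positive mass of a cell. With [dl <= d0 / 4], good sets meet every cell of positive
   mass. *)
have [d0 d00 hd0] : exists2 d0 : R, 0 < d0 & forall i, (i < N)%N -> 0 < m i -> d0 <= m i.
  elim: (N) => [|k [d d0 hd]]; first by exists 1.
  have [mk|mk] := ltP 0 (m k); last first.
    exists d => // i; rewrite ltnS leq_eqVlt => /orP[/eqP ->|]; last exact: hd.
    by rewrite ltNge mk.
  exists (Num.min d (m k)); first by rewrite lt_min d0.
  move=> i; rewrite ltnS leq_eqVlt => /orP[/eqP -> _|ik mi0]; first by rewrite ge_min lexx orbT.
  by rewrite ge_min hd.
pose dl := Num.min (d0 / 4) (eta / N.+1%:R).
have dl0 : 0 < dl by rewrite lt_min !divr_gt0.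
have dld : dl <= d0 / 4 by rewrite ge_min lexx.
have Ndl : N%:R * dl <= eta - dl.
  have : dl <= eta / N.+1%:R by rewrite ge_min lexx orbT.
  by rewrite ler_pdivlMr// -natr1 mulrDr mulr1 (mulrC dl); lra.
have Ndl0 : 0 <= N%:R * dl by rewrite mulr_ge0// ltW.
exists dl => // X phi psi hphi hpsi YX XY Z zeta hzeta hz; exists phi, zeta.
have mA i : measurable ([set s | idx (phi s) = i] : set TR) by exact: (law_meas hphi (mi i)).
have lA : 1 - eta <= pr (unif R) (~` [set s | idx (phi s) = N]).
  by rewrite prC// lerD2l lerN2 [leLHS](law_pr hphi (mi N)) ltW.
have mN' : measurable (~` [set s | idx (phi s) = N] : set TR) by exact: measurableC.
have near_net s : idx (phi s) <> N -> mm_dist (x (idx (phi s))) (phi s) < eta.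
  by move=> /eqP h; apply: ltN; rewrite ltn_neqAle h leN.
have near_cell i s t : (i < N)%N -> idx (phi s) = i -> idx (phi t) = i ->
    mm_dist (phi s) (phi t) <= 2 * eta.
  move=> iN si ti; have := ltN (phi s); have := ltN (phi t); rewrite si ti => /(_ iN) h1 /(_ iN) h2.
  have := mmd_tri (phi s) (x i) (phi t); rewrite (mmdC (phi s) (x i)); lra.
split => //.
(* From [Y] to [Z] only the distance functions of the net points are transferred to [X]. They yield
   the distance of [Y] bounded by that of [X] plus a small error, off a small set. *)
- have [|i iN|J [mJ lJ hJ]] := @finite_pr_inter N dl (fun i s t =>
    mm_dist (x i) (phi s) - mm_dist (x i) (phi t) <= mm_dist (psi s) (psi t) + 2 * dl).
  + exact: ltW.
  + have [g lg [E [mE lE hE]]] := YX _ (lip1_dist (x i)); exists E; split => // s t Es Et.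
    have := hE s Es; have := hE t Et; have := lg (psi s) (psi t).
    by rewrite !ler_norml /= => /andP[? ?] /andP[? ?] /andP[? ?]; lra.
  move=> f lf.
  apply: (@lip1_transfer Z zeta (f \o phi) (J `&` ~` [set s | idx (phi s) = N])).
  + exact: ltW.
  + exact: measurableI.
  + have := prI_ge mJ mN' lJ lA; rewrite /eta in Ndl *; lra.
  move=> s t [Js /= sN] [Jt _]; have ns := near_net s sN.
  have {}sN : (idx (phi s) < N)%N by rewrite ltn_neqAle leN andbT; exact/eqP.
  have h1 := hJ (idx (phi s)) t s sN Jt Js.
  have h2 := lf (phi s) (phi t); have h3 := mmd_tri (phi s) (x (idx (phi s))) (phi t).
  rewrite (mmdC (phi s) (x _)) in h3; rewrite (mmdC (psi t) (psi s)) in h1.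
  move: h2; rewrite ler_norml /= => /andP[_ h2].
  have := hz s t => /andP[+ _]; rewrite ge_min => /orP[h4|h4]; rewrite /eta in ns Ndl *; lra.
- move=> F lF.
  have [|i iN|J [mJ lJ hJ]] := @finite_pr_inter N (2 * dl) (fun i s t => idx (phi s) = i ->
    `|F (zeta s) - F (zeta t)| <= mm_dist (phi s) (phi t) + 13 * eta).
  + by rewrite mulr_ge0// ltW.
  + have [m0|m0] := ltP 0 (m i); last first.
      (* A null cell is simply discarded. *)
      exists (~` [set s | idx (phi s) = i]); split; first exact: measurableC.
        rewrite prC// [pr _ _](law_pr hphi (mi i)) -/(m i); lra.
      by move=> s t ns _ /ns.
    have dm := hd0 i iN m0.
    (* Inside a cell the distance of [Z] exceeds that of [X] by at most the diameter [2 * eta] of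
       the cell in [Y]. So [F] restricted to the cell extends to [X]; its counterpart [g] on [Y]
       varies little on the cell, and hence so does [F]. *)
    have [|G lG hG] := @mcshane R X R [set s | idx (phi s) = i] psi (F \o zeta) (2 * eta).
      move=> s t si ti /=; have := lF (zeta s) (zeta t); rewrite ler_norml => /andP[_ h1].
      have h2 := near_cell i s t iN si ti; have h3 := mmd_ge0 (psi s) (psi t).
      by have := hz s t => /andP[_]; rewrite le_max => /orP[h4|h4]; lra.
    have [g lg [E [mE lE hE]]] := XY G lG.
    pose K : set TR := [set s | idx (phi s) = i] `&` E.
    have mK : measurable K by exact: measurableI.
    have mA_ : pr (unif R) [set s | idx (phi s) = i] = m i by exact: (law_pr hphi (mi i)).
    have lK : 1 - (1 - m i + dl) <= pr (unif R) K by apply: prI_ge => //; rewrite mA_; lra.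
    have osc s t : K s -> K t -> `|F (zeta s) - F (zeta t)| <= 6 * eta.
      move=> [si Es] [ti Et]; have := hG s si; have := hG t ti; have := hE s Es; have := hE t Et.
      have := lg (phi s) (phi t); have := near_cell i s t iN si ti.
      rewrite !ler_norml /= => h0 /andP[h1 h2] /andP[h3 h4] /andP[h5 h6] /andP[h7 h8] /andP[h9 h10].
      by apply/andP; split; lra.
    (* Transferring the distance to the cell from [X] to [Y] shows that a point near the cell in [Y]
       is near some point of it in [X]; the small oscillation of [F] makes the choice of that point
       irrelevant. *)
    have [|H [lH H0 Hd]] := @set_dist X K psi; first by apply: (pr_neq0 (P := unif R)); lra.
    have [h lh [L [mL lL hL]]] := XY H lH.
    have [s0 [Ks0 Ls0]] : K `&` L !=set0.
      by apply: (pr_neq0 (P := unif R)); have := prI_ge mK mL lK lL; lra.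
    exists (E `&` L); split; first exact: measurableI.
      by have := prI_ge mE mL lE lL; lra.
    move=> t s' [Et Lt] [Es' Ls'] ti; have Kt : K t by [].
    have [s Ks hs] := Hd (psi s') eta eta0.
    have h1 := H0 s0 Ks0; have h2 := hL s0 Ls0; have h3 := hL s' Ls'.
    have h4 := lh (phi s') (phi s0); have h5 := osc t s Kt Ks.
    have h6 := near_cell i t s0 iN ti (proj1 Ks0); have h7 := near_cell i s s0 iN (proj1 Ks) (proj1 Ks0).
    have h8 := lF (zeta s) (zeta s'); have /andP[_ h9] := hz s s'.
    have h10 := mmd_tri (phi s) (phi s0) (phi s'); have h11 := mmd_tri (phi s0) (phi t) (phi s').
    rewrite (mmdC (phi s0) (phi t)) in h11; rewrite (mmdC (phi s') (phi s0)) in h4.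
    apply: (le_trans (ler_distD (F (zeta s)) _ _)).
    move: h2 h3 h4; rewrite !ler_norml /= => /andP[h21 h22] /andP[h31 h32] /andP[h41 h42].
    have h12 : mm_dist (zeta s) (zeta s') <= mm_dist (phi t) (phi s') + 7 * eta.
      by move: h9; rewrite le_max => /orP[h9|h9]; lra.
    lra.
  have [||||k lk hk] := @lip1_transfer Y phi (F \o zeta) (J `&` ~` [set s | idx (phi s) = N]) e.
  + exact: ltW.
  + exact: measurableI.
  + have := prI_ge mJ mN' lJ lA; rewrite /eta in Ndl *; lra.
  + move=> s t [Js /= /eqP ns] [Jt _] /=.
    have sN : (idx (phi s) < N)%N by rewrite ltn_neqAle ns leN.
    have := hJ _ s t sN Js Jt erefl; rewrite ler_norml => /andP[_]; rewrite /eta; lra.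
  by exists k => //; exact: close_sym.
Qed.

Lemma conc_locally_path_connected : locally_path_connected R (@conc_open R).
Proof.
apply: lpc_criterion => U x oU Ux Y xY.
have UY : U Y by have [g [_ _ <- h]] := xY; apply: h; rewrite ler01 lexx.
have [e e0 he] := oU Y UY; have e2 : 0 < e / 2 by rewrite divr_gt0.
(* As [dl] depends only on [Y] and [e], it serves all [X] in the ball of radius [dl] around [Y]. *)
have [dl dl0 hdl] := conc_stable Y e2; exists dl => // X /dconc_lt[phi [psi [hphi hpsi YX XY]]].
apply: joined_trans xY _; have [g [g0 g1 gz gc]] := linpath hphi hpsi.
exists g; split => //.
  move=> V oV t t01 Vt; have [r r0 hr] := oV _ Vt; have r2 : 0 < r / 2 by rewrite divr_gt0.
  have [d d0 hd] := gc _ r2; exists d => // s s01 st; apply: hr.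
  apply: (@le_lt_trans _ _ (r / 2)); last lra.
  apply: dconc_concle; first exact: ltW.
  by apply: boxle_concle; [exact: ltW|apply: hd => //; rewrite distrC].
move=> t t01; have [z [hz dz]] := gz t t01; apply: he.
apply: (@le_lt_trans _ _ (e / 2)); last lra.
apply: dconc_concle; first exact: ltW.
apply: (hdl X phi psi hphi hpsi YX XY _ z hz) => s s'; rewrite dz.
case/andP: t01 => t0 t1; have t1' : 0 <= 1 - t by rewrite subr_ge0.
set a := mm_dist (phi s) _; set b := mm_dist (psi s) _.
have lo c : c <= a -> c <= b -> c <= (1 - t) * a + t * b.
  move=> ca cb; have h1 : (1 - t) * c <= (1 - t) * a by exact: ler_wpM2l.
  have h2 : t * c <= t * b by exact: ler_wpM2l.
  by apply: le_trans (lerD h1 h2); rewrite -mulrDl subrK mul1r.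
have hi c : a <= c -> b <= c -> (1 - t) * a + t * b <= c.
  move=> ca cb; have h1 : (1 - t) * a <= (1 - t) * c by exact: ler_wpM2l.
  have h2 : t * b <= t * c by exact: ler_wpM2l.
  by apply: le_trans (lerD h1 h2) _; rewrite -mulrDl subrK mul1r.
by rewrite lo ?hi ?ge_min ?le_max ?lexx ?orbT.
Qed.

End concentration.

Theorem theorem1p6 (R : realType) :
  locally_path_connected R (@conc_open R) /\
  locally_path_connected R (@weak_open R).
Proof.
split; [exact: conc_locally_path_connected|exact: weak_locally_path_connected].
Qed.
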